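(* There exists a dense set of eccentricities $e \in [0,1)$ such that any ellipse of eccentricity $e$ has at least two rational caustics of distinct types $(p,q)$ and $(p',q')$, with all corresponding orbits (the periodic billiard orbits tangent to either caustic) having the same length. Moreover, for any $m, n \in \mathbb{Z}$, one can choose such caustics to satisfy $q = q' + m \mod n$.
   Context: Billiard trajectories in a strictly convex planar domain are straight segments reflecting at the boundary with equal angles of incidence and reflection. A closed curve $\Gamma$ in the domain $\Omega$ is a caustic if tangency to $\Gamma$ of any one link of a billiard orbit implies tangency to $\Gamma$ of all past and future links. It is a rational caustic if all billiard trajectories tangent to it are periodic; in that case all these orbits share a common rotation number and a common length. A periodic orbit is of type $(p,q)$ if $q$ is its number of reflections (bounce number, period) and $p$ is its winding number, i.e. the lift of the billiard map to the universal cover shifts the boundary arclength coordinate by $p|\partial\Omega|$ after $q$ iterations; its rotation number is $p/q$. A rational caustic is of type $(p,q)$ if the periodic orbits tangent to it are of type $(p,q)$. *)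

(* Defs.v *)
From Stdlib Require Import Reals ZArith Rgeom.
From Coquelicot Require Import Coquelicot.
Open Scope R_scope.

Notation point := (R * R)%type.

Definition edist (P Q : point) : R := dist_euc (fst P) (snd P) (fst Q) (snd Q).
Definition vec (P Q : point) : point := (fst Q - fst P, snd Q - snd P).
Definition dot (u v : point) : R := fst u * fst v + snd u * snd v.
Definition cross (u v : point) : R := fst u * snd v - snd u * fst v.

Definition boundary (Omega : point -> Prop) (P : point) : Prop :=
  ~ locally P Omega /\ ~ locally P (fun Q => ~ Omega Q).

Definition velocity (c : R -> point) (t : R) : point :=
  (Derive (fun s => fst (c s)) t, Derive (fun s => snd (c s)) t).

Definition speed (c : R -> point) (t : R) : R :=
  sqrt (dot (velocity c t) (velocity c t)).

Definition arclength (c : R -> point) (a b : R) : R := RInt (speed c) a b.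

(* [c] is a regular C^1 parametrization, of minimal period [T] and of either
   orientation, of the simple closed curve with image [Gamma]. *)
Record parametrizes (c : R -> point) (T : R) (Gamma : point -> Prop) : Prop := {
  param_period_pos : 0 < T;
  param_derivable : forall t,
    ex_derive (fun s => fst (c s)) t /\ ex_derive (fun s => snd (c s)) t;
  param_C1 : forall t, continuous (velocity c) t;
  param_regular : forall t, velocity c t <> (0, 0);
  param_periodic : forall t, c (t + T) = c t;
  param_simple : forall s t, c s = c t -> exists k : Z, s = t + IZR k * T;
  param_image : forall P, Gamma P <-> exists t, c t = P
}.

Definition closed_curve (Gamma : point -> Prop) : Prop :=
  exists c T, parametrizes c T Gamma.

Definition tangent_vector (Gamma : point -> Prop) (P v : point) : Prop :=
  exists c T t, parametrizes c T Gamma /\ c t = P /\ velocity c t = v.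

Definition on_segment (A B P : point) : Prop :=
  exists s, 0 <= s <= 1 /\
    P = (fst A + s * (fst B - fst A), snd A + s * (snd B - snd A)).

Definition tangent_link (Gamma : point -> Prop) (A B : point) : Prop :=
  exists P v, tangent_vector Gamma P v /\ on_segment A B P /\
    cross (vec A B) v = 0.

(* Equal angles: the unit directions of [A -> P] and [P -> B] have the same
   component along the tangent [v] and opposite components across it. *)
Definition reflects (A P B v : point) : Prop :=
  dot (vec A P) v / edist A P = dot (vec P B) v / edist P B /\
  cross (vec A P) v / edist A P = - (cross (vec P B) v / edist P B).

(* The sequence of successive bounce points of a (bi-infinite) trajectory.
   The domain is meant to be strictly convex, so that the chords between
   distinct boundary points automatically run inside it. *)
Definition billiard_orbit (Omega : point -> Prop) (x : Z -> point) : Prop :=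
  (forall k, boundary Omega (x k)) /\
  (forall k, x k <> x (k + 1)%Z) /\
  (forall k, exists v, tangent_vector (boundary Omega) (x k) v /\
     reflects (x (k - 1)%Z) (x k) (x (k + 1)%Z) v).

Definition tangent_orbit (Omega Gamma : point -> Prop) (x : Z -> point) : Prop :=
  billiard_orbit Omega x /\
  exists k, tangent_link Gamma (x k) (x (k + 1)%Z).

Definition caustic (Omega Gamma : point -> Prop) : Prop :=
  closed_curve Gamma /\
  (forall P, Gamma P -> Omega P) /\
  (forall x, tangent_orbit Omega Gamma x ->
     forall k, tangent_link Gamma (x k) (x (k + 1)%Z)).

Definition has_period (x : Z -> point) (q : nat) : Prop :=
  (0 < q)%nat /\ forall k, x (k + Z.of_nat q)%Z = x k.

Definition minimal_period (x : Z -> point) (q : nat) : Prop :=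
  has_period x q /\ forall r, has_period x r -> (q <= r)%nat.

(* [t] is the lift of the orbit to the universal cover of the boundary.
   Traversing the boundary in the opposite direction exchanges the winding
   numbers [p] and [q - p]; both directions are allowed for [c], and the
   normalization [2 * p <= q] makes the type that of the unoriented orbit. *)
Definition orbit_type (Omega : point -> Prop) (x : Z -> point) (p q : nat)
    : Prop :=
  minimal_period x q /\ (2 * p <= q)%nat /\
  exists (c : R -> point) (T : R) (t : Z -> R),
    parametrizes c T (boundary Omega) /\
    (forall k, c (t k) = x k) /\
    (forall k, t k < t (k + 1)%Z < t k + T) /\
    (forall k, arclength c (t k) (t (k + Z.of_nat q)%Z)
               = INR p * arclength c 0 T).

Definition rational_caustic (Omega Gamma : point -> Prop) : Prop :=
  caustic Omega Gamma /\
  (forall x, tangent_orbit Omega Gamma x -> exists q, has_period x q).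

Definition rational_caustic_of_type (Omega Gamma : point -> Prop) (p q : nat)
    : Prop :=
  rational_caustic Omega Gamma /\
  (forall x, tangent_orbit Omega Gamma x -> orbit_type Omega x p q).

(* Total length of [q] consecutive links, for [q > 0]. *)
Definition orbit_length (x : Z -> point) (q : nat) : R :=
  sum_n (fun i => edist (x (Z.of_nat i)) (x (Z.of_nat i + 1)%Z)) (pred q).

Definition equal_length_caustics (Omega : point -> Prop) (p q p' q' : nat)
    : Prop :=
  exists Gamma Gamma' : point -> Prop,
    Gamma <> Gamma' /\
    rational_caustic_of_type Omega Gamma p q /\
    rational_caustic_of_type Omega Gamma' p' q' /\
    (p, q) <> (p', q') /\
    exists L : R,
      (forall x, tangent_orbit Omega Gamma x -> orbit_length x q = L) /\
      (forall x, tangent_orbit Omega Gamma' x -> orbit_length x q' = L).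

(* The open region bounded by the ellipse with foci [F1], [F2] and major
   semi-axis [a]; nondegenerate when [edist F1 F2 < 2 * a]. *)
Definition ellipse (F1 F2 : point) (a : R) (P : point) : Prop :=
  edist P F1 + edist P F2 < 2 * a.

Definition eccentricity (F1 F2 : point) (a : R) : R := edist F1 F2 / (2 * a).

Definition dense_in_01 (E : R -> Prop) : Prop :=
  (forall e, E e -> 0 <= e < 1) /\
  (forall e0, 0 <= e0 < 1 -> forall eps, 0 < eps ->
     exists e, E e /\ Rabs (e - e0) < eps).

(* Main.v *)
(** Normalize the boundary to [x^2 + y^2 / b^2 = 1] with [0 < b < 1], and let the confocal ellipse
    with squared semi-axes [1 - s^2] and [b^2 - s^2], [0 < s < b], be the caustic.  With
    [D t = sin^2 t + b^2 cos^2 t], a chord with ends of eccentric angles [m - d] and [m + d]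
    touches it iff [sin d = (s / b) sqrt (D m)].  Differentiating in [m] shows that the integral
    over [m - d, m + d] of [1 / sqrt (D - s^2)] is constant (the billiard map is a rotation in this
    coordinate), and so is the length of the chord minus the integral of [sqrt (D - s^2)] (the
    string construction).  Hence the orbits on the caustic close up with type [(p, q)]
    iff [q G (asin s) = 2 p G (pi / 2)], where [G] is the primitive of [1 / sqrt (D - s^2)], and
    all of them then have the length
      [L_{p,q} (b, s) = q (2 b s - 2 K (asin s)) + 4 p K (pi / 2)],
    where [K] is the primitive of [sqrt (D - s^2)].

    The closing condition is [dL / ds = 0], and [L] has an interior minimum over [0 <= s <= b];
    its value [l_{p,q} (b)] is continuous in [b], so no uniqueness or smooth dependence of the caustic
    is needed.  As [q] grows, [l_{p,q}] tends to [p] perimeters, whereas [l_{p',2p'+1}] stays within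
    half a perimeter of [2 q'] (near-diametral orbits).  The perimeter increases strictly with [b], so
    integers in suitable residue classes can be chosen for which [l_{p,q} - l_{p',q'}] changes sign on a
    given interval of [b]; it vanishes at an intermediate [b]. *)

Require Import Defs.
From Stdlib Require Import Reals ZArith Rgeom Lra Lia Psatz.
From Stdlib Require Import FunctionalExtensionality PropExtensionality.
From Coquelicot Require Import Coquelicot.
Open Scope R_scope.

(** The comparison of the two lengths rests on the normalization: the major axis has length 2 for
    every [b], so [2 q'] stays fixed while [p] perimeters drift with [b]. A large [p] makes this
    drift across the given interval exceed the half perimeter of slack plus the cost of rounding to
    an odd [q'].

    The ends of [0 <= s <= b] are degenerate caustics: the boundary itself at [s = 0], the focal
    segment at [s = b]. The rotation number tends to 0 at the first and to 1/2 at the second, where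
    [G] diverges logarithmically; hence for [0 < p / q < 1/2] the derivative of the length has
    opposite signs near the two ends, and the minimum is reached inside. Because of that divergence,
    continuity up to [s = b] is argued with [K] alone, which is Hölder there.

    The definitions allow every regular parametrization and both senses of travel. The first freedom
    is removed by differentiating the equation of the ellipse, the second by a mirror image, which
    is why the similarities used for the normalization include the orientation-reversing ones. *)

(** * Primitives of continuous, even and periodic functions *)

Lemma ex_RInt_cont (f : R -> R) (a b : R) :
  (forall x, continuous f x) -> ex_RInt f a b.
Proof. intros Hf. apply (ex_RInt_continuous (V := R_CompleteNormedModule)). auto. Qed.

Lemma is_derive_value (f : R -> R) (x l l' : R) : is_derive f x l -> l = l' -> is_derive f x l'.
Proof. intros H <-. exact H. Qed.

Lemma is_derive_primitive (f : R -> R) (x : R) :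
  (forall y, continuous f y) -> is_derive (fun y => RInt f 0 y) x (f x).
Proof.
  intros Hf. apply (is_derive_RInt f (fun y => RInt f 0 y) 0).
  - apply filter_forall. intros y. apply (RInt_correct (V := R_CompleteNormedModule)).
    apply ex_RInt_cont; auto.
  - apply Hf.
Qed.

Lemma constant_of_derive_0 (f : R -> R) (x y : R) :
  (forall t, is_derive f t 0) -> f x = f y.
Proof.
  intros Hf. destruct (Rtotal_order x y) as [H|[H|H]].
  - apply (eq_is_derive (V := R_NormedModule) f x y); auto.
  - now subst.
  - symmetry. apply (eq_is_derive (V := R_NormedModule) f y x); auto.
Qed.

Lemma increasing_of_derive_pos (f df : R -> R) (x y : R) :
  (forall t, is_derive f t (df t)) -> (forall t, 0 < df t) -> x < y -> f x < f y.
Proof.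
  intros Hd Hp Hxy.
  destruct (MVT_gen f x y df) as [c [_ Hc]].
  - auto.
  - intros t _. apply derivable_continuous_pt. exists (df t).
    apply is_derive_Reals. apply Hd.
  - specialize (Hp c). nra.
Qed.

Lemma RInt_as_primitive (f : R -> R) (a b : R) :
  (forall x, continuous f x) -> RInt f a b = RInt f 0 b - RInt f 0 a.
Proof.
  intros Hf.
  assert (H := RInt_Chasles (V := R_CompleteNormedModule) f 0 a b
    (ex_RInt_cont f 0 a Hf) (ex_RInt_cont f a b Hf)).
  change (RInt f 0 a + RInt f a b = RInt f 0 b) in H. lra.
Qed.

Lemma primitive_odd (f : R -> R) (x : R) :
  (forall y, continuous f y) -> (forall y, f (- y) = f y) ->
  RInt f 0 (- x) = - RInt f 0 x.
Proof.
  intros Hf He.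
  pose (h := fun y => RInt f 0 (- y) + RInt f 0 y).
  assert (H : h x = h 0).
  { apply constant_of_derive_0. intros t. unfold h.
    apply is_derive_value with (- 1 * f (- t) + f t); [|rewrite He; ring].
    apply (is_derive_plus (V := R_NormedModule)).
    - apply (is_derive_comp (V := R_NormedModule) (fun y => RInt f 0 y) Ropp t (f (- t)) (-1)).
      + apply is_derive_primitive; auto.
      + auto_derive; auto.
    - apply is_derive_primitive; auto. }
  unfold h in H. rewrite Ropp_0, (RInt_point (V := R_CompleteNormedModule)) in H.
  change (zero : R) with 0 in H. lra.
Qed.

Lemma primitive_shift (f : R -> R) (x : R) :
  (forall y, continuous f y) -> (forall y, f (- y) = f y) ->
  (forall y, f (y + PI) = f y) ->
  RInt f 0 (x + PI) = RInt f 0 x + 2 * RInt f 0 (PI / 2).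
Proof.
  intros Hf He Hp.
  pose (h := fun y => RInt f 0 (y + PI) - RInt f 0 y).
  (* At [- (PI / 2)] the difference is an integral over a symmetric interval of length [PI], which
     parity turns into twice the quarter integral. *)
  assert (H : h x = h (- (PI / 2))).
  { apply constant_of_derive_0. intros t. unfold h.
    apply is_derive_value with (1 * f (t + PI) - f t); [|rewrite Hp; ring].
    apply (is_derive_minus (V := R_NormedModule)).
    - apply (is_derive_comp (V := R_NormedModule) (fun y => RInt f 0 y) (fun y => y + PI) t (f (t + PI)) 1).
      + apply is_derive_primitive; auto.
      + auto_derive; auto.
    - apply is_derive_primitive; auto. }
  unfold h in H. rewrite primitive_odd in H by auto.
  replace (- (PI / 2) + PI) with (PI / 2) in H by field. lra.
Qed.

Lemma primitive_shift_nat (f : R -> R) (x : R) (k : nat) :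
  (forall y, continuous f y) -> (forall y, f (- y) = f y) ->
  (forall y, f (y + PI) = f y) ->
  RInt f 0 (x + INR k * (2 * PI)) = RInt f 0 x + INR k * (4 * RInt f 0 (PI / 2)).
Proof.
  intros Hf He Hp. induction k as [|k IH].
  - simpl. rewrite 2!Rmult_0_l, 2!Rplus_0_r. reflexivity.
  - rewrite S_INR.
    replace (x + (INR k + 1) * (2 * PI)) with (x + INR k * (2 * PI) + PI + PI) by ring.
    rewrite 2!primitive_shift by auto. rewrite IH.
    match goal with |- ?l = ?r => change (@eq R l r) end. ring.
Qed.

(** Since [sqrt] is 0 on negative numbers, Hölder continuity of exponent 1/2 holds on the whole
    line. It controls [radical] up to [s = b], where the radicand can vanish and a Lipschitz bound
    fails. *)
Lemma sqrt_diff_le (x y : R) : Rabs (sqrt x - sqrt y) <= sqrt (Rabs (x - y)).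
Proof.
  assert (W : forall x y, y <= x -> sqrt x <= sqrt y + sqrt (x - y)).
  { clear. intros x y Hxy. destruct (Rle_lt_dec 0 y) as [Hy|Hy].
    - assert (0 <= sqrt y + sqrt (x - y)) by (generalize (sqrt_pos y) (sqrt_pos (x - y)); lra).
      rewrite <- (sqrt_Rsqr (sqrt y + sqrt (x - y))) by auto.
      apply sqrt_le_1_alt. unfold Rsqr.
      generalize (sqrt_sqrt y Hy) (sqrt_sqrt (x - y) ltac:(lra)) (sqrt_pos y) (sqrt_pos (x - y)).
      nra.
    - rewrite (sqrt_neg_0 y) by lra. rewrite Rplus_0_l. apply sqrt_le_1_alt. lra. }
  destruct (Rle_dec y x) as [H|H].
  - rewrite (Rabs_pos_eq (x - y)) by lra. rewrite Rabs_pos_eq.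
    + generalize (W x y H). lra.
    + generalize (sqrt_le_1_alt y x H). lra.
  - rewrite (Rabs_left1 (x - y)) by lra. rewrite Rabs_left1.
    + replace (- (x - y)) with (y - x) by ring. generalize (W y x ltac:(lra)). lra.
    + generalize (sqrt_le_1_alt x y ltac:(lra)). lra.
Qed.

Lemma continuous_sqrt_comp (f : R -> R) (x : R) :
  continuous f x -> continuous (fun y => sqrt (f y)) x.
Proof.
  intros Hf. apply (continuous_comp f sqrt x Hf), continuous_sqrt.
Qed.

(** * Elliptic integrals of the billiard *)

Definition speed_sq (b t : R) : R := sin t * sin t + b * b * (cos t * cos t).

Lemma speed_sq_sin b t : speed_sq b t = b * b + (1 - b * b) * (sin t * sin t).
Proof. unfold speed_sq. generalize (sin2_cos2 t). unfold Rsqr. intros H.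
  replace (cos t * cos t) with (1 - sin t * sin t) by lra. ring. Qed.

Lemma speed_sq_opp b t : speed_sq b (- t) = speed_sq b t.
Proof. unfold speed_sq. rewrite sin_neg, cos_neg. ring. Qed.

Lemma speed_sq_pi b t : speed_sq b (t + PI) = speed_sq b t.
Proof. unfold speed_sq. rewrite neg_sin, neg_cos. ring. Qed.

Lemma sin_sq_bound t : 0 <= sin t * sin t <= 1.
Proof. generalize (sin2_cos2 t). unfold Rsqr. intros H. nra. Qed.

Lemma speed_sq_lower b t : 0 <= b <= 1 -> b * b <= speed_sq b t.
Proof. intros Hb. rewrite speed_sq_sin. destruct (sin_sq_bound t). assert (0 <= 1 - b * b) by nra. nra. Qed.

Lemma speed_sq_upper b t : 0 <= b <= 1 -> speed_sq b t <= 1.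
Proof. intros Hb. rewrite speed_sq_sin. destruct (sin_sq_bound t). assert (0 <= 1 - b * b) by nra. nra. Qed.

Definition radical (b s t : R) : R := sqrt (speed_sq b t - s * s).
Definition kint (b s x : R) : R := RInt (radical b s) 0 x.
Definition gint (b s x : R) : R := RInt (fun t => / radical b s t) 0 x.

Lemma speed_sq_continuous b t : continuous (speed_sq b) t.
Proof.
  apply (ex_derive_continuous (V := R_NormedModule)). unfold speed_sq. auto_derive. auto.
Qed.

Lemma radical_continuous b s t : continuous (radical b s) t.
Proof.
  apply continuous_sqrt_comp.
  apply (continuous_minus (V := R_NormedModule)); [apply speed_sq_continuous|apply continuous_const].
Qed.

Lemma radical_opp b s t : radical b s (- t) = radical b s t.
Proof. unfold radical. now rewrite speed_sq_opp. Qed.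

Lemma radical_pi b s t : radical b s (t + PI) = radical b s t.
Proof. unfold radical. now rewrite speed_sq_pi. Qed.

Lemma radical_pos b s t : 0 <= s < b -> b <= 1 -> 0 < radical b s t.
Proof.
  intros Hs Hb. apply sqrt_lt_R0. assert (H := speed_sq_lower b t ltac:(lra)). nra.
Qed.

Lemma inv_radical_continuous b s t : 0 <= s < b -> b <= 1 ->
  continuous (fun x => / radical b s x) t.
Proof.
  intros Hs Hb. apply (continuous_comp (radical b s) Rinv).
  - apply radical_continuous.
  - apply continuous_Rinv. generalize (radical_pos b s t Hs Hb). lra.
Qed.

Lemma gint_derive b s x : 0 <= s < b -> b <= 1 ->
  is_derive (gint b s) x (/ radical b s x).
Proof.
  intros Hs Hb. apply (is_derive_primitive (fun t => / radical b s t)).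
  intros y. apply inv_radical_continuous; auto.
Qed.

Lemma kint_derive b s x : is_derive (kint b s) x (radical b s x).
Proof. apply (is_derive_primitive (radical b s)). apply radical_continuous. Qed.

Lemma gint_increasing b s x y : 0 <= s < b -> b <= 1 -> x < y -> gint b s x < gint b s y.
Proof.
  intros Hs Hb. apply increasing_of_derive_pos with (df := fun t => / radical b s t).
  - intros t. apply gint_derive; auto.
  - intros t. apply Rinv_0_lt_compat, radical_pos; auto.
Qed.

Lemma gint_0 b s : gint b s 0 = 0.
Proof. apply (RInt_point (V := R_CompleteNormedModule)). Qed.

Lemma kint_0 b s : kint b s 0 = 0.
Proof. apply (RInt_point (V := R_CompleteNormedModule)). Qed.

Lemma gint_opp b s x : 0 <= s < b -> b <= 1 -> gint b s (- x) = - gint b s x.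
Proof.
  intros Hs Hb. apply primitive_odd.
  - intros y. apply inv_radical_continuous; auto.
  - intros y. now rewrite radical_opp.
Qed.

Lemma kint_opp b s x : kint b s (- x) = - kint b s x.
Proof. apply primitive_odd; [apply radical_continuous|apply radical_opp]. Qed.

Lemma gint_shift b s x k : 0 <= s < b -> b <= 1 ->
  gint b s (x + INR k * (2 * PI)) = gint b s x + INR k * (4 * gint b s (PI / 2)).
Proof.
  intros Hs Hb. apply (primitive_shift_nat (fun t => / radical b s t)).
  - intros y. apply inv_radical_continuous; auto.
  - intros y. now rewrite radical_opp.
  - intros y. now rewrite radical_pi.
Qed.

Lemma kint_shift b s x k :
  kint b s (x + INR k * (2 * PI)) = kint b s x + INR k * (4 * kint b s (PI / 2)).
Proof.
  apply (primitive_shift_nat (radical b s));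
    [apply radical_continuous|apply radical_opp|apply radical_pi].
Qed.

(** * Links tangent to a confocal ellipse *)

Section Link.
Variables b s : R.
Hypothesis Hs : 0 < s < b.
Hypothesis Hb : b < 1.

Definition half_angle (m : R) : R := asin (s / b * sqrt (speed_sq b m)).
(** Mean and half-difference of the values of [radical] at the two ends of the link with middle
    angle [m]. The quotient [radical_skew / radical_mean] is the derivative of [half_angle], so each
    end moves at a rate proportional to [radical] there; both invariants of the link rest on
    this. *)
Definition radical_mean (m : R) : R := sqrt (speed_sq b m) * cos (half_angle m).
Definition radical_skew (m : R) : R := s * (1 - b * b) / b * (sin m * cos m).

Lemma speed_sq_pos m : 0 < speed_sq b m.
Proof. assert (H := speed_sq_lower b m ltac:(lra)). nra. Qed.

Lemma sin_half_bound m : 0 < s / b * sqrt (speed_sq b m) < 1.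
Proof.
  assert (H1 := sqrt_lt_R0 _ (speed_sq_pos m)).
  assert (H2 : sqrt (speed_sq b m) <= 1).
  { rewrite <- sqrt_1. apply sqrt_le_1_alt, speed_sq_upper. lra. }
  assert (H3 : 0 < s / b < 1).
  { split. apply Rdiv_lt_0_compat; lra. apply Rmult_lt_reg_r with b. lra. field_simplify; lra. }
  split; nra.
Qed.

Lemma half_angle_bounds m : 0 < half_angle m < PI / 2.
Proof.
  generalize (sin_half_bound m). intros H. unfold half_angle. split.
  - rewrite <- asin_0. destruct (asin_bound_lt (s / b * sqrt (speed_sq b m)) ltac:(lra)) as [A B].
    apply Rnot_le_lt. intros C. rewrite asin_0 in C.
    assert (D := sin_le_0 (- asin (s / b * sqrt (speed_sq b m)))).
    assert (E := sin_ge_0 (- asin (s / b * sqrt (speed_sq b m))) ltac:(lra) ltac:(generalize PI_RGT_0; lra)).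
    rewrite sin_neg, sin_asin in E by lra. lra.
  - destruct (asin_bound_lt (s / b * sqrt (speed_sq b m)) ltac:(lra)). auto.
Qed.

Lemma sin_half_angle m : sin (half_angle m) = s / b * sqrt (speed_sq b m).
Proof. apply sin_asin. generalize (sin_half_bound m). lra. Qed.

Lemma sin_half_angle_pos m : 0 < sin (half_angle m).
Proof. rewrite sin_half_angle. apply sin_half_bound. Qed.

Lemma cos_half_angle_pos m : 0 < cos (half_angle m).
Proof. apply cos_gt_0; generalize (half_angle_bounds m); lra. Qed.

Lemma sin_half_angle_sq m :
  sin (half_angle m) * sin (half_angle m) = s * s / (b * b) * speed_sq b m.
Proof.
  rewrite sin_half_angle.
  transitivity (s * s / (b * b) * (sqrt (speed_sq b m) * sqrt (speed_sq b m))). field; lra.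
  rewrite sqrt_sqrt. reflexivity. generalize (speed_sq_pos m); lra.
Qed.

Lemma radical_mean_pos m : 0 < radical_mean m.
Proof.
  apply Rmult_lt_0_compat. apply sqrt_lt_R0, speed_sq_pos. apply cos_half_angle_pos.
Qed.

Lemma radical_mean_sq m : radical_mean m * radical_mean m = speed_sq b m * (1 - s * s / (b * b) * speed_sq b m).
Proof.
  unfold radical_mean. rewrite <- sin_half_angle_sq.
  transitivity (sqrt (speed_sq b m) * sqrt (speed_sq b m) * (cos (half_angle m) * cos (half_angle m))). ring.
  rewrite sqrt_sqrt by (generalize (speed_sq_pos m); lra).
  generalize (sin2_cos2 (half_angle m)). unfold Rsqr. intros H.
  replace (cos (half_angle m) * cos (half_angle m)) with (1 - sin (half_angle m) * sin (half_angle m)) by lra.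
  reflexivity.
Qed.

Lemma radical_skew_sq m : radical_skew m * radical_skew m =
  s * s / (b * b) * (1 - b * b) * (1 - b * b) * (sin m * sin m * (1 - sin m * sin m)).
Proof.
  unfold radical_skew. generalize (sin2_cos2 m). unfold Rsqr. intros H.
  replace (1 - sin m * sin m) with (cos m * cos m) by lra. field. lra.
Qed.

(** This fixes the signs of the square roots in [radical_end] and [radical_start]. In the notation
    of the proof the claim becomes [r * (y * y + z) < y], which follows from [r < 1] and [y - (y * y
    + z) = c * (1 - c) * (1 - x) >= 0]. *)
Lemma radical_skew_bounds m : - radical_mean m < radical_skew m < radical_mean m.
Proof.
  assert (H : radical_skew m * radical_skew m < radical_mean m * radical_mean m).
  { rewrite radical_mean_sq, radical_skew_sq, speed_sq_sin. set (x := sin m * sin m).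
    assert (Hx : 0 <= x <= 1) by apply sin_sq_bound.
    assert (Hr : 0 < s * s / (b * b) < 1).
    { split. apply Rdiv_lt_0_compat; nra. apply Rmult_lt_reg_r with (b * b). nra. field_simplify; nra. }
    set (r := s * s / (b * b)) in *.
    set (c := 1 - b * b). assert (Hc : 0 < c < 1) by (unfold c; nra).
    replace (b * b) with (1 - c) by (unfold c; ring).
    clearbody x c r.
    assert (P : (1 - c + c * x) * (1 - c + c * x) + c * c * (x * (1 - x)) <= 1 - c + c * x).
    { assert (0 <= (1 - c) * (c * (1 - x))) by (repeat apply Rmult_le_pos; lra). nra. }
    assert (Q : 0 < (1 - c + c * x) * (1 - c + c * x) + c * c * (x * (1 - x))).
    { assert (0 <= c * x) by nra. assert (0 <= c * c * (x * (1 - x))) by (repeat apply Rmult_le_pos; lra).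
      assert (0 < (1 - c + c * x) * (1 - c + c * x)) by (apply Rmult_lt_0_compat; lra). lra. }
    assert (H0 : 0 <= 1 - c + c * x) by nra.
    set (y := 1 - c + c * x) in *. set (z := c * c * (x * (1 - x))) in *.
    replace (r * c * c * (x * (1 - x))) with (r * z) by (unfold z; ring).
    assert (r * (y * y + z) < y) by nra. nra. }
  assert (P := radical_mean_pos m). nra.
Qed.

Lemma speed_sq_plus m e :
  speed_sq b (m + e) = b * b + (1 - b * b) * (sin m * cos e + cos m * sin e) ^ 2.
Proof. rewrite speed_sq_sin, sin_plus. ring. Qed.

Lemma radical_mean_skew_sq m :
  let S := sin (half_angle m) in let C := cos (half_angle m) in
  (radical_mean m + radical_skew m) ^ 2 = b * b + (1 - b * b) * (sin m * C + cos m * S) ^ 2 - s * s /\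
  (radical_mean m - radical_skew m) ^ 2 = b * b + (1 - b * b) * (sin m * C - cos m * S) ^ 2 - s * s.
Proof.
  intros S C.
  assert (E1 : 2 * (radical_mean m * radical_skew m) = 2 * (1 - b * b) * (sin m * cos m * S * C)).
  { unfold radical_mean, radical_skew. fold C.
    assert (HS : S = s / b * sqrt (speed_sq b m)) by apply sin_half_angle.
    rewrite HS. field. lra. }
  assert (E2 : radical_mean m * radical_mean m + radical_skew m * radical_skew m = b * b - s * s
     + (1 - b * b) * (sin m * sin m * (C * C) + cos m * cos m * (S * S))).
  { rewrite radical_mean_sq, radical_skew_sq.
    assert (HS : S * S = s * s / (b * b) * speed_sq b m) by apply sin_half_angle_sq.
    assert (HC : C * C = 1 - S * S).
    { unfold S, C. generalize (sin2_cos2 (half_angle m)). unfold Rsqr. lra. }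
    assert (Hm : cos m * cos m = 1 - sin m * sin m).
    { generalize (sin2_cos2 m). unfold Rsqr. lra. }
    rewrite HC, Hm, HS, speed_sq_sin. set (x := sin m * sin m). field. lra. }
  split; nra.
Qed.

Lemma radical_end m : radical b s (m + half_angle m) = radical_mean m + radical_skew m.
Proof.
  unfold radical. rewrite speed_sq_plus.
  rewrite <- (proj1 (radical_mean_skew_sq m)). rewrite <- Rsqr_pow2.
  apply sqrt_Rsqr. generalize (radical_skew_bounds m). lra.
Qed.

Lemma radical_start m : radical b s (m - half_angle m) = radical_mean m - radical_skew m.
Proof.
  unfold radical. unfold Rminus at 2. rewrite speed_sq_plus, sin_neg, cos_neg.
  replace (sin m * cos (half_angle m) + cos m * - sin (half_angle m))
    with (sin m * cos (half_angle m) - cos m * sin (half_angle m)) by ring.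
  rewrite <- (proj2 (radical_mean_skew_sq m)). rewrite <- Rsqr_pow2.
  apply sqrt_Rsqr. generalize (radical_skew_bounds m). lra.
Qed.

Lemma is_derive_asin x : -1 < x < 1 -> is_derive asin x (/ cos (asin x)).
Proof.
  intros Hx. apply is_derive_Reals.
  assert (H := derive_pt_asin x Hx). unfold derive_pt in H.
  destruct (derivable_pt_asin x Hx) as [l Hl]. simpl in H. subst l.
  rewrite cos_asin by lra. replace (/ sqrt (1 - x²)) with (1 / sqrt (1 - x²)) by (unfold Rdiv; ring).
  exact Hl.
Qed.

Lemma is_derive_half_angle m : is_derive half_angle m (radical_skew m / radical_mean m).
Proof.
  assert (H := sin_half_bound m).
  assert (Hd := sqrt_lt_R0 _ (speed_sq_pos m)).
  apply is_derive_value with (s / b * ((1 - b * b) * (sin m * cos m) / sqrt (speed_sq b m)) * / cos (half_angle m)).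
  - unfold half_angle. apply (is_derive_comp asin).
    + apply is_derive_asin. lra.
    + apply (is_derive_scal (fun m => sqrt (speed_sq b m)) m (s / b)).
      assert (P := speed_sq_pos m). unfold speed_sq in *. auto_derive. auto. field. apply Rgt_not_eq. auto.
  - unfold radical_skew, radical_mean. field. generalize (cos_half_angle_pos m). lra.
Qed.

(* Chasles: the density [1 / radical] is invariant under the billiard map along the caustic. *)
Lemma gint_link m :
  gint b s (m + half_angle m) - gint b s (m - half_angle m) = 2 * gint b s (asin s).
Proof.
  pose (h := fun x => gint b s (x + half_angle x) - gint b s (x - half_angle x)).
  assert (H : h m = h 0).
  { apply constant_of_derive_0. intros t. unfold h.
    assert (U := radical_mean_pos t). assert (N := radical_skew_bounds t).
    apply is_derive_value with ((1 + radical_skew t / radical_mean t) * / radical b s (t + half_angle t)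
       - (1 - radical_skew t / radical_mean t) * / radical b s (t - half_angle t)).
    2: { rewrite radical_end, radical_start. field. repeat split; lra. }
    apply (is_derive_minus (V := R_NormedModule)).
    - apply (is_derive_comp (V := R_NormedModule) (gint b s) (fun x => x + half_angle x)).
      + apply gint_derive; lra.
      + apply (is_derive_plus (V := R_NormedModule) (fun x => x) half_angle).
        apply (is_derive_id t). apply is_derive_half_angle.
    - apply (is_derive_comp (V := R_NormedModule) (gint b s) (fun x => x - half_angle x)).
      + apply gint_derive; lra.
      + apply (is_derive_minus (V := R_NormedModule) (fun x => x) half_angle).
        apply (is_derive_id t). apply is_derive_half_angle. }
  unfold h in H. rewrite H.
  assert (E : half_angle 0 = asin s).
  { unfold half_angle. f_equal. unfold speed_sq. rewrite sin_0, cos_0.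
    replace (0 * 0 + b * b * (1 * 1)) with (b * b) by ring. rewrite sqrt_square by lra. field; lra. }
  rewrite E, Rplus_0_l, Rminus_0_l, gint_opp by lra. ring.
Qed.

(* Graves: the excess of the link over the arc integral of [radical] does not depend on the link. *)
Lemma kint_link m :
  2 * s / b * speed_sq b m - (kint b s (m + half_angle m) - kint b s (m - half_angle m))
  = 2 * b * s - 2 * kint b s (asin s).
Proof.
  pose (h := fun x => 2 * s / b * speed_sq b x - (kint b s (x + half_angle x) - kint b s (x - half_angle x))).
  assert (H : h m = h 0).
  { apply constant_of_derive_0. intros t. unfold h.
    assert (U := radical_mean_pos t). assert (N := radical_skew_bounds t).
    apply is_derive_value with (2 * s / b * (2 * (1 - b * b) * (sin t * cos t)) - ((1 + radical_skew t / radical_mean t) * radical b s (t + half_angle t)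
       - (1 - radical_skew t / radical_mean t) * radical b s (t - half_angle t))).
    2: { rewrite radical_end, radical_start.
         transitivity (2 * s / b * (2 * (1 - b * b) * (sin t * cos t)) - 4 * radical_skew t).
         field; repeat split; lra. unfold radical_skew. field. lra. }
    apply (is_derive_minus (V := R_NormedModule)).
    - apply (is_derive_scal (speed_sq b)). unfold speed_sq. auto_derive. auto. ring.
    - apply (is_derive_minus (V := R_NormedModule)).
      + apply (is_derive_comp (V := R_NormedModule) (kint b s) (fun x => x + half_angle x)).
        * apply kint_derive; lra.
        * apply (is_derive_plus (V := R_NormedModule) (fun x => x) half_angle).
          apply (is_derive_id t). apply is_derive_half_angle.
      + apply (is_derive_comp (V := R_NormedModule) (kint b s) (fun x => x - half_angle x)).
        * apply kint_derive; lra.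
        * apply (is_derive_minus (V := R_NormedModule) (fun x => x) half_angle).
          apply (is_derive_id t). apply is_derive_half_angle. }
  unfold h in H. rewrite H.
  assert (E0 : speed_sq b 0 = b * b) by (unfold speed_sq; rewrite sin_0, cos_0; ring).
  assert (E : half_angle 0 = asin s).
  { unfold half_angle. f_equal. rewrite E0. rewrite sqrt_square by lra. field; lra. }
  rewrite E, E0, Rplus_0_l, Rminus_0_l, kint_opp by lra. field. lra.
Qed.

(** Links are indexed by their middle angle, so the link leaving a given boundary point has to be
    found by an intermediate value argument; [half_angle] lying between 0 and [PI / 2] supplies the
    bracket. *)
Lemma link_start_exists f : exists m, m - half_angle m = f.
Proof.
  destruct (IVT_gen (fun m => m - half_angle m) f (f + PI / 2) f) as [m [_ Hm]].
  - intros x. apply derivable_continuous_pt. exists (1 - radical_skew x / radical_mean x). apply is_derive_Reals.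
    apply (is_derive_minus (V := R_NormedModule) (fun x => x) half_angle).
    apply (is_derive_id x). apply is_derive_half_angle.
  - generalize (half_angle_bounds f) (half_angle_bounds (f + PI / 2)). intros A B.
    rewrite Rmin_left, Rmax_right by lra. lra.
  - exists m. exact Hm.
Qed.

End Link.

(** * Arcsine estimates *)

Lemma PI2_bounds : 1 < PI / 2 <= 2.
Proof. generalize PI2_3_2 PI_4. lra. Qed.

Lemma asin_increasing x y : -1 <= x -> y <= 1 -> x < y -> asin x < asin y.
Proof.
  intros Hx Hy Hxy. apply Rnot_le_lt. intros H.
  assert (A := asin_bound x). assert (B := asin_bound y).
  assert (sin (asin y) <= sin (asin x)) by (apply sin_incr_1; lra).
  rewrite !sin_asin in H0 by lra. lra.
Qed.

Lemma asin_pos x : 0 <= x <= 1 -> 0 <= asin x <= PI / 2.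
Proof.
  intros Hx. split; [|apply asin_bound]. destruct (Req_dec x 0) as [->|N].
  - rewrite asin_0. lra.
  - rewrite <- asin_0. apply Rlt_le, asin_increasing; lra.
Qed.

Lemma cos_asin_pos x : 0 <= x < 1 -> 0 < cos (asin x).
Proof. intros Hx. apply cos_gt_0; destruct (asin_bound_lt x); lra. Qed.

Lemma cos_asin_sq x : 0 <= x < 1 -> cos (asin x) * cos (asin x) = 1 - x * x.
Proof.
  intros Hx. generalize (sin2_cos2 (asin x)). rewrite sin_asin by lra. unfold Rsqr. lra.
Qed.

Lemma asin_lipschitz r x y : 0 <= r < 1 -> Rabs x <= r -> Rabs y <= r ->
  Rabs (asin x - asin y) <= Rabs (x - y) / sqrt (1 - r * r).
Proof.
  intros Hr Hx Hy. apply Rabs_le_between in Hx, Hy.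
  assert (B : forall z, Rmin y x <= z <= Rmax y x -> -r <= z <= r).
  { intros z. unfold Rmin, Rmax. destruct (Rle_dec y x); lra. }
  destruct (MVT_gen asin y x (fun z => / cos (asin z))) as [c [Hc E]].
  - intros z Hz. apply is_derive_asin. specialize (B z). lra.
  - intros z Hz. apply derivable_continuous_pt, derivable_pt_asin. specialize (B z Hz). lra.
  - rewrite E, Rabs_mult, Rmult_comm. apply Rmult_le_compat_l. apply Rabs_pos.
    specialize (B c Hc). rewrite cos_asin by lra.
    assert (0 < sqrt (1 - r * r)) by (apply sqrt_lt_R0; nra).
    assert (sqrt (1 - r * r) <= sqrt (1 - c²)) by (apply sqrt_le_1_alt; unfold Rsqr; nra).
    rewrite Rabs_pos_eq by (apply Rlt_le, Rinv_0_lt_compat; lra).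
    apply Rinv_le_contravar; lra.
Qed.

(** * The length as a function of the caustic *)

(* For the caustic of a periodic orbit of type [(p, q)] this is the length of the orbit; its
   derivative in [s] is the defect of the closing condition, so that the closed
   caustics are the interior critical points. *)
Definition closed_length (p q b s : R) : R :=
  q * (2 * b * s - 2 * kint b s (asin s)) + 4 * p * kint b s (PI / 2).

Lemma radical_le_1 b s t : 0 <= b <= 1 -> 0 <= radical b s t <= 1.
Proof.
  intros Hb. split. apply sqrt_pos. rewrite <- sqrt_1. apply sqrt_le_1_alt.
  generalize (speed_sq_upper b t Hb). nra.
Qed.

Lemma RInt_le_abs (f g : R -> R) (a b M : R) : a <= b ->
  (forall x, continuous f x) -> (forall x, continuous g x) ->
  (forall x, a <= x <= b -> Rabs (f x - g x) <= M) ->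
  Rabs (RInt f a b - RInt g a b) <= (b - a) * M.
Proof.
  intros Hab Hf Hg H.
  assert (E := RInt_minus (V := R_CompleteNormedModule) f g a b
    (ex_RInt_cont f a b Hf) (ex_RInt_cont g a b Hg)).
  change (RInt (fun x => f x - g x) a b = RInt f a b - RInt g a b) in E.
  rewrite <- E. apply abs_RInt_le_const; auto.
  apply ex_RInt_cont. intros x. apply (continuous_minus (V := R_NormedModule)); auto.
Qed.

(** The radicand changes by at most [4 * h], hence [radical] by at most [2 * sqrt h], over an
    interval of length at most 2; moving the end point costs [Rabs (x - x')] because [radical] is at
    most 1. *)
Lemma kint_modulus b b' s s' x x' h :
  0 <= b <= 1 -> 0 <= b' <= 1 -> Rabs s <= 1 -> Rabs s' <= 1 ->
  0 <= x <= PI / 2 -> 0 <= x' <= PI / 2 -> Rabs (b - b') <= h -> Rabs (s - s') <= h ->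
  Rabs (kint b s x - kint b' s' x') <= 4 * sqrt h + Rabs (x - x').
Proof.
  intros Hb Hb' Hs Hs' Hx Hx' H1 H2.
  assert (P2 := PI2_bounds).
  assert (Hh : 0 <= h) by (generalize (Rabs_pos (b - b')); lra).
  assert (A : Rabs (kint b s x - kint b' s' x) <= 4 * sqrt h).
  { apply Rle_trans with ((x - 0) * (sqrt (4 * h))).
    - apply RInt_le_abs; try apply radical_continuous. lra.
      intros t Ht. unfold radical. eapply Rle_trans. apply sqrt_diff_le.
      apply sqrt_le_1_alt. unfold speed_sq.
      replace (sin t * sin t + b * b * (cos t * cos t) - s * s -
        (sin t * sin t + b' * b' * (cos t * cos t) - s' * s'))
        with ((b - b') * ((b + b') * (cos t * cos t)) + (s - s') * - (s + s')) by ring.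
      eapply Rle_trans. apply Rabs_triang. rewrite (Rabs_mult (b - b')), (Rabs_mult (s - s')).
      assert (Rabs ((b + b') * (cos t * cos t)) <= 2).
      { assert (C : 0 <= cos t * cos t <= 1) by (generalize (sin2_cos2 t); unfold Rsqr; nra).
        rewrite Rabs_pos_eq; nra. }
      assert (Rabs (- (s + s')) <= 2) by (rewrite Rabs_Ropp; eapply Rle_trans; [apply Rabs_triang|lra]).
      replace (4 * h) with (h * 2 + h * 2) by ring.
      apply Rplus_le_compat; apply Rmult_le_compat; auto; apply Rabs_pos.
    - replace 4 with (2 * 2) at 1 by ring. rewrite sqrt_mult, sqrt_square by lra.
      generalize (sqrt_pos h). nra. }
  assert (B : forall y z, y <= z -> Rabs (kint b' s' z - kint b' s' y) <= z - y).
  { intros y z Hyz. unfold kint.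
    rewrite <- (RInt_as_primitive _ y z) by apply radical_continuous.
    replace (z - y) with ((z - y) * 1) by ring. apply abs_RInt_le_const; auto.
    apply ex_RInt_cont, radical_continuous.
    intros t _. generalize (radical_le_1 b' s' t Hb'). intros ?. rewrite Rabs_pos_eq; lra. }
  replace (kint b s x - kint b' s' x') with
    ((kint b s x - kint b' s' x) + (kint b' s' x - kint b' s' x')) by ring.
  eapply Rle_trans. apply Rabs_triang. apply Rplus_le_compat. exact A.
  destruct (Rle_dec x x').
  - rewrite (Rabs_minus_sym x), (Rabs_minus_sym (kint _ _ _)). rewrite (Rabs_pos_eq (x' - x)) by lra. auto.
  - rewrite (Rabs_pos_eq (x - x')) by lra. apply B. lra.
Qed.

(** The bound [r < 1] keeps [asin] Lipschitz. Both [b] and [s] vary, because the interval of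
    admissible [s] moves with the ellipse. *)
Lemma closed_length_modulus p q r : 0 <= p -> 0 <= q -> 0 <= r < 1 -> exists C, 0 <= C /\
  forall b b' s s' h, 0 <= b <= 1 -> 0 <= b' <= 1 -> 0 <= s <= r -> 0 <= s' <= r ->
  Rabs (b - b') <= h -> Rabs (s - s') <= h -> h <= 1 ->
  Rabs (closed_length p q b s - closed_length p q b' s') <= C * sqrt h.
Proof.
  intros Hp Hq Hr. set (k := sqrt (1 - r * r)).
  assert (Hk : 0 < k) by (apply sqrt_lt_R0; nra).
  exists (q * (12 + 2 / k) + 16 * p).
  assert (Hk' : 0 < / k) by now apply Rinv_0_lt_compat.
  split. unfold Rdiv; nra.
  intros b b' s s' h Hb Hb' Hs Hs' H1 H2 H3.
  assert (P2 := PI2_bounds).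
  assert (Hh : 0 <= h) by (generalize (Rabs_pos (b - b')); lra).
  assert (Hh' : h <= sqrt h).
  { generalize (sqrt_sqrt h Hh) (sqrt_pos h). intros.
    assert (sqrt h <= 1) by (rewrite <- sqrt_1; apply sqrt_le_1_alt; lra). nra. }
  assert (K1 := kint_modulus b b' s s' (asin s) (asin s') h Hb Hb'
    ltac:(rewrite Rabs_pos_eq; lra) ltac:(rewrite Rabs_pos_eq; lra)
    ltac:(apply asin_pos; lra) ltac:(apply asin_pos; lra) H1 H2).
  assert (K2 := kint_modulus b b' s s' (PI / 2) (PI / 2) h Hb Hb'
    ltac:(rewrite Rabs_pos_eq; lra) ltac:(rewrite Rabs_pos_eq; lra)
    ltac:(lra) ltac:(lra) H1 H2).
  rewrite Rminus_diag, Rabs_R0 in K2.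
  assert (K3 := asin_lipschitz r s s' Hr ltac:(rewrite Rabs_pos_eq; lra) ltac:(rewrite Rabs_pos_eq; lra)).
  fold k in K3.
  assert (K4 : Rabs (s - s') / k <= sqrt h * / k).
  { apply Rmult_le_compat_r; lra. }
  apply Rabs_le_between in K1, K2, H1, H2.
  assert (K5 : - (2 * sqrt h) <= b * s - b' * s' <= 2 * sqrt h).
  { replace (b * s - b' * s') with ((b - b') * s + b' * (s - s')) by ring. split; nra. }
  apply Rabs_le_between. unfold closed_length.
  set (A := kint b s (asin s)) in *. set (A' := kint b' s' (asin s')) in *.
  set (B := kint b s (PI / 2)) in *. set (B' := kint b' s' (PI / 2)) in *.
  replace (q * (2 * b * s - 2 * A) + 4 * p * B - (q * (2 * b' * s' - 2 * A') + 4 * p * B'))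
    with (q * (2 * (b * s - b' * s') - 2 * (A - A')) + p * (4 * (B - B'))) by ring.
  replace ((q * (12 + 2 / k) + 16 * p) * sqrt h) with
    (q * (12 * sqrt h + 2 * (sqrt h * / k)) + p * (16 * sqrt h)) by (field; lra).
  split; [rewrite Ropp_plus_distr, 2!Ropp_mult_distr_r|];
    apply Rplus_le_compat; apply Rmult_le_compat_l; lra.
Qed.

Lemma closed_length_continuous p q b s r : 0 <= p -> 0 <= q -> 0 <= b <= 1 -> 0 <= s <= r -> r < 1 ->
  forall eps, 0 < eps -> exists d, 0 < d /\ forall s', 0 <= s' <= r -> Rabs (s' - s) < d ->
    Rabs (closed_length p q b s' - closed_length p q b s) < eps.
Proof.
  intros Hp Hq Hb Hs Hr eps He.
  destruct (closed_length_modulus p q r Hp Hq ltac:(lra)) as [C [HC H]].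
  exists (Rmin 1 ((eps / (C + 1)) * (eps / (C + 1)) )).
  assert (Hx : 0 < eps / (C + 1)) by (apply Rdiv_lt_0_compat; lra).
  set (x := eps / (C + 1)) in *.
  split. apply Rmin_pos; nra.
  intros s' Hs' Hd. set (d := Rmin 1 (x * x)) in *.
  assert (D1 : d <= 1) by apply Rmin_l. assert (D2 : d <= x * x) by apply Rmin_r.
  apply Rle_lt_trans with (C * sqrt d).
  - apply H; try lra. rewrite Rminus_diag, Rabs_R0. apply Rle_trans with (Rabs (s' - s)).
    apply Rabs_pos. lra.
  - assert (sqrt d <= x). { rewrite <- (sqrt_square x) by lra. now apply sqrt_le_1_alt. }
    assert (x * (C + 1) = eps) by (unfold x; field; lra). nra.
Qed.

(** * Differentiation with respect to the caustic *)

Lemma Derive_radical b u v : Rabs u < b -> b <= 1 ->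
  is_derive (fun z => radical b z v) u (- u / radical b u v).
Proof.
  intros Hu Hb. apply Rabs_lt_between in Hu.
  assert (H : 0 < speed_sq b v - u * u) by (assert (H := speed_sq_lower b v ltac:(lra)); nra).
  unfold radical. auto_derive. exact H.
  change (speed_sq b v + - (u * u)) with (speed_sq b v - u * u). field. apply Rgt_not_eq, sqrt_lt_R0. exact H.
Qed.

Lemma continuity_2d_radical b u v : Rabs u < b -> b <= 1 ->
  continuity_2d_pt (fun x y => Derive (fun z => radical b z y) x) u v.
Proof.
  intros Hu Hb.
  apply (continuity_2d_pt_ext_loc (fun x y => (- x) * / radical b x y)).
  { assert (He : 0 < b - Rabs u) by lra. exists (mkposreal _ He). simpl. intros x y Hx _.
    symmetry. apply is_derive_unique, Derive_radical; auto.
    replace x with (u + (x - u)) by ring. eapply Rle_lt_trans. apply Rabs_triang. lra. }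
  assert (H : 0 < speed_sq b v - u * u).
  { apply Rabs_lt_between in Hu. assert (H := speed_sq_lower b v ltac:(lra)). nra. }
  apply continuity_2d_pt_mult.
  - apply continuity_2d_pt_opp, continuity_2d_pt_id1.
  - apply continuity_2d_pt_inv.
    + apply (continuity_1d_2d_pt_comp sqrt (fun x y => speed_sq b y - x * x)).
      apply continuity_pt_sqrt. lra.
      apply continuity_2d_pt_minus.
      * apply (continuity_1d_2d_pt_comp (speed_sq b) (fun _ y => y)).
        apply continuity_pt_filterlim, speed_sq_continuous. apply continuity_2d_pt_id2.
      * apply continuity_2d_pt_mult; apply continuity_2d_pt_id1.
    + apply Rgt_not_eq, sqrt_lt_R0. exact H.
Qed.

(** Differentiation under the integral sign: the derivative of [radical] in [s] is [- s / radical],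
    which turns [kint] into [- s * gint]; the moving end point adds its boundary term. *)
Lemma kint_param_derive b (e : R -> R) de s : 0 < s < b -> b <= 1 ->
  is_derive e s de ->
  is_derive (fun u => kint b u (e u)) s (- s * gint b s (e s) + radical b s (e s) * de).
Proof.
  intros Hs Hb He.
  assert (Hd : 0 < Rmin s (b - s)) by (apply Rmin_pos; lra).
  set (d := mkposreal _ Hd).
  assert (L : forall u, ball s d u -> Rabs u < b).
  { intros u Hu. change (Rabs (u - s) < Rmin s (b - s)) in Hu.
    assert (D1 := Rmin_l s (b - s)). assert (D2 := Rmin_r s (b - s)).
    apply Rabs_lt_between in Hu. apply Rabs_lt_between. lra. }
  assert (Hss : Rabs s < b) by (rewrite Rabs_pos_eq; lra).
  assert (X : forall a c, locally s (fun y => ex_RInt (fun t => radical b y t) a c)).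
  { intros a c. apply filter_forall. intros y. apply ex_RInt_cont, radical_continuous. }
  unfold kint. eapply is_derive_value.
  - apply (is_derive_RInt_param_bound_comp_aux3 (radical b) 0 e s de); auto.
    + exists (mkposreal 1 Rlt_0_1). apply X.
    + exists (mkposreal 1 Rlt_0_1). exists d. intros u Hu t _.
      exists (- u / radical b u t). apply Derive_radical; auto.
    + intros t _. apply continuity_2d_radical; auto.
    + apply locally_2d_locally. exists d. intros [u v] [Hu _]. simpl in *.
      apply continuity_2d_radical; auto.
    + apply continuity_pt_filterlim, radical_continuous.
  - apply (f_equal (fun z => z + radical b s (e s) * de)).
    unfold gint. rewrite (RInt_ext _ (fun t => scal (- s) (/ radical b s t))).
    + rewrite (RInt_scal (V := R_CompleteNormedModule)). reflexivity.
      apply ex_RInt_cont. intros x. apply inv_radical_continuous; lra.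
    + intros x _. apply is_derive_unique. apply Derive_radical; auto.
Qed.

Lemma radical_asin b s : 0 <= s < 1 -> 0 <= b ->
  radical b s (asin s) = b * cos (asin s).
Proof.
  intros Hs Hb. unfold radical, speed_sq. rewrite sin_asin by lra.
  replace (s * s + b * b * (cos (asin s) * cos (asin s)) - s * s)
    with ((b * cos (asin s)) * (b * cos (asin s))) by ring.
  apply sqrt_square. generalize (cos_asin_pos s Hs). nra.
Qed.

(** The end point [asin s] contributes [radical b s (asin s) / cos (asin s) = b], which cancels the
    derivative of [b * s]; only the [gint] terms survive. *)
Lemma closed_length_derive p q b s : 0 < s < b -> b < 1 ->
  is_derive (closed_length p q b) s (2 * s * (q * gint b s (asin s) - 2 * p * gint b s (PI / 2))).
Proof.
  intros Hs Hb. unfold closed_length.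
  apply is_derive_value with (q * (2 * b * 1 - 2 * (- s * gint b s (asin s) + radical b s (asin s) * / cos (asin s)))
    + 4 * p * (- s * gint b s (PI / 2) + radical b s (PI / 2) * 0)).
  - apply (is_derive_plus (V := R_NormedModule)).
    + apply is_derive_scal. apply (is_derive_minus (V := R_NormedModule)).
      * apply (is_derive_scal (fun x => x)). apply (is_derive_id s).
      * apply is_derive_scal. apply kint_param_derive; try lra. apply is_derive_asin. lra.
    + apply is_derive_scal. apply (kint_param_derive b (fun _ => PI / 2)); try lra.
      apply (is_derive_const (V := R_NormedModule)).
  - rewrite radical_asin by lra. field. generalize (cos_asin_pos s ltac:(lra)). lra.
Qed.

(** * Rotation near the degenerate caustics, and the interior minimum *)

Lemma RInt_ge_const (f : R -> R) (a b m : R) : a <= b -> (forall x, continuous f x) ->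
  (forall x, a <= x <= b -> m <= f x) -> m * (b - a) <= RInt f a b.
Proof.
  intros Hab Hf H. replace (m * (b - a)) with (RInt (fun _ => m) a b).
  - apply RInt_le; auto. apply ex_RInt_cont. intros; apply continuous_const.
    apply ex_RInt_cont; auto. intros; apply H; lra.
  - rewrite (RInt_const (V := R_CompleteNormedModule)). apply Rmult_comm.
Qed.

Lemma RInt_le_const (f : R -> R) (a b m : R) : a <= b -> (forall x, continuous f x) ->
  (forall x, a <= x <= b -> f x <= m) -> RInt f a b <= m * (b - a).
Proof.
  intros Hab Hf H. replace (m * (b - a)) with (RInt (fun _ => m) a b).
  - apply RInt_le; auto. apply ex_RInt_cont; auto. apply ex_RInt_cont. intros; apply continuous_const.
    intros; apply H; lra.
  - rewrite (RInt_const (V := R_CompleteNormedModule)). apply Rmult_comm.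
Qed.

Lemma gint_quarter_lower b s : 0 <= s < b -> b <= 1 -> PI / 2 <= gint b s (PI / 2).
Proof.
  intros Hs Hb. replace (PI / 2) with (1 * (PI / 2 - 0)) at 1 by ring.
  apply RInt_ge_const. generalize PI2_bounds; lra.
  intros; apply inv_radical_continuous; lra.
  intros x _. rewrite <- Rinv_1. generalize (radical_pos b s x Hs Hb) (radical_le_1 b s x ltac:(lra)).
  intros. apply Rinv_le_contravar; lra.
Qed.

Lemma gint_upper b s x : 0 <= s < b -> b <= 1 -> 0 <= x ->
  gint b s x <= / sqrt (b * b - s * s) * x.
Proof.
  intros Hs Hb Hx. rewrite <- (Rminus_0_r x) at 2. apply RInt_le_const; auto.
  intros; apply inv_radical_continuous; lra.
  intros t _. apply Rinv_le_contravar. apply sqrt_lt_R0; nra.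
  apply sqrt_le_1_alt. generalize (speed_sq_lower b t ltac:(lra)). lra.
Qed.

(** The integral up to [asin s] shrinks with [s], while the quarter integral stays above
    [PI / 2 > 1]: the rotation number tends to 0 as the caustic approaches the boundary. *)
Lemma rotation_small p q b : 0 < p -> 0 < q -> 0 < b < 1 ->
  exists s0, 0 < s0 < b /\ forall s, 0 < s <= s0 ->
    q * gint b s (asin s) <= 2 * p * gint b s (PI / 2).
Proof.
  intros Hp Hq Hb. assert (P2 := PI2_bounds).
  (* The entry [b / 2] keeps the integrand below [2 / b]; the entry [p * b / q] then makes [q] times
     the integral at most [2 * p]. *)
  set (x := Rmin (b / 2) (p * b / q)).
  assert (Hx1 : x <= b / 2) by apply Rmin_l.
  assert (Hx2 : x <= p * b / q) by apply Rmin_r.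
  assert (Hx0 : 0 < x). { apply Rmin_pos. lra. apply Rdiv_lt_0_compat; nra. }
  assert (Hsx : 0 < sin x < x). { split. apply sin_gt_0; lra. apply sin_lt_x; lra. }
  exists (sin x). split. lra.
  intros s Hs.
  assert (A : asin s <= x).
  { destruct Hs as [Hs1 [Hs|Hs]].
    - rewrite <- (asin_sin x) by lra. apply Rlt_le, asin_increasing; lra.
    - rewrite Hs, asin_sin; lra. }
  assert (A0 := asin_pos s ltac:(lra)).
  assert (G := gint_upper b s (asin s) ltac:(lra) ltac:(lra) ltac:(lra)).
  assert (R : / sqrt (b * b - s * s) <= 2 / b).
  { replace (2 / b) with (/ (b / 2)) by (field; lra). apply Rinv_le_contravar. lra.
    rewrite <- (sqrt_square (b / 2)) by lra. apply sqrt_le_1_alt. nra. }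
  assert (G2 := gint_quarter_lower b s ltac:(lra) ltac:(lra)).
  assert (gint b s (asin s) <= 2 / b * x).
  { eapply Rle_trans. apply G. apply Rmult_le_compat; try lra.
    apply Rlt_le, Rinv_0_lt_compat, sqrt_lt_R0. nra. }
  assert (2 / b * x <= 2 / b * (p * b / q)).
  { apply Rmult_le_compat_l; auto. apply Rlt_le, Rdiv_lt_0_compat; lra. }
  assert (q * (2 / b * (p * b / q)) = 2 * p) by (field; lra).
  nra.
Qed.

Lemma sin_sub_sq a x : 0 <= a <= x -> x <= PI / 2 -> sin a * sin a <= sin x * sin x.
Proof.
  intros Ha Hx. generalize PI2_bounds. intros P2.
  assert (sin a <= sin x) by (apply sin_incr_1; lra).
  assert (0 <= sin a) by (apply sin_ge_0; lra). nra.
Qed.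

(** The right side minus the left side is [b * b - s * s] times the square of [cos t]; in particular
    the two sides agree at [s = b]. *)
Lemma radical_sq_beyond b s t : 0 <= s <= b -> b < 1 -> asin s <= t <= PI / 2 ->
  (1 - s * s) * (sin t * sin t) <= speed_sq b t - s * s.
Proof.
  intros Hs Hb Ht. unfold speed_sq. generalize (sin2_cos2 t). unfold Rsqr. intros H.
  replace (cos t * cos t) with (1 - sin t * sin t) by lra.
  generalize (sin_sq_bound t). intros. assert (s * s <= b * b) by nra. nra.
Qed.

Lemma is_RInt_log e x : 0 < e -> 0 <= x ->
  is_RInt (fun t => / (e + t)) 0 x (ln (e + x) - ln (e + 0)).
Proof.
  intros He Hx. apply (is_RInt_derive (V := R_CompleteNormedModule) (fun t => ln (e + t)) (fun t => / (e + t))).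
  - rewrite Rmin_left, Rmax_right by lra. intros t Ht. auto_derive. lra. field. lra.
  - rewrite Rmin_left, Rmax_right by lra. intros t Ht.
    apply (ex_derive_continuous (V := R_NormedModule)). auto_derive. lra.
Qed.

(** With [e * e = b * b - s * s], the radicand is at most the square of [e + t] on the first arc, so
    its integral exceeds a logarithm that diverges as [s] tends to [b]. Beyond [asin s] the integral
    stays bounded. Hence the rotation number tends to 1/2, past [p / q]. *)
Lemma rotation_large p q b : 0 < p -> 2 * p < q -> 0 < b < 1 ->
  exists s0, 0 < s0 < b /\ forall s, s0 <= s < b ->
    2 * p * gint b s (PI / 2) <= q * gint b s (asin s).
Proof.
  intros Hp Hq Hb. assert (P2 := PI2_bounds).
  set (k := sqrt (1 - b * b)). assert (Hk : 0 < k) by (apply sqrt_lt_R0; nra).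
  (* [2 / (b / 2 * k)] bounds the integral from [asin s] to [PI / 2]; [M] is the size of the first
     integral from which the claim follows. *)
  set (M := 2 * p * (2 / (b / 2 * k)) / (q - 2 * p)).
  assert (HM : 0 < M).
  { apply Rdiv_lt_0_compat; [|lra]. apply Rmult_lt_0_compat. lra. apply Rdiv_lt_0_compat; nra. }
  (* For [e <= e0] and [asin s >= b / 2] the logarithm of [(e + asin s) / e] is at least [M]. *)
  set (e0 := b / 2 * exp (- M)).
  assert (HE : 0 < exp (- M) < 1). { split. apply exp_pos. rewrite <- exp_0. apply exp_increasing. lra. }
  assert (He0 : 0 < e0 < b / 2). { unfold e0. split; nra. }
  exists (sqrt (b * b - e0 * e0)).
  assert (Hs0 : 0 < b * b - e0 * e0) by nra.
  split.
  { split. apply sqrt_lt_R0; auto. apply Rlt_le_trans with (sqrt (b * b)).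
    apply sqrt_lt_1; nra. rewrite sqrt_square; lra. }
  intros s [Hs1 Hs2].
  assert (Hs3 : b * b - e0 * e0 <= s * s).
  { generalize (sqrt_sqrt (b * b - e0 * e0) ltac:(lra)) (sqrt_pos (b * b - e0 * e0)). nra. }
  assert (Hs4 : b / 2 <= s). { generalize (sqrt_pos (b * b - e0 * e0)). intros. apply Rnot_lt_le. intros F.
    assert (e0 * e0 < b / 2 * (b / 2)) by nra. assert (0 <= s) by lra. assert (s * s < b / 2 * (b / 2)) by nra. nra. }
  set (e := sqrt (b * b - s * s)).
  assert (He : 0 < e) by (apply sqrt_lt_R0; nra).
  assert (Hee : e * e = b * b - s * s) by (apply sqrt_sqrt; nra).
  assert (He1 : e <= e0) by (apply Rnot_lt_le; intros F; nra).
  assert (A0 := asin_pos s ltac:(lra)).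
  assert (A1 : s <= asin s).
  { assert (W : sin (asin s) = s) by (apply sin_asin; lra).
    destruct (Req_dec (asin s) 0) as [Z|Z]. rewrite Z, sin_0 in W. lra.
    generalize (sin_lt_x (asin s) ltac:(lra)). lra. }
  assert (G1 : M <= gint b s (asin s)).
  { apply Rle_trans with (ln (e + asin s) - ln (e + 0)).
    - rewrite Rplus_0_r.
      assert (M + ln e <= ln (e + asin s)); [|lra].
      rewrite <- (ln_exp M) at 1. rewrite <- ln_mult by (auto; apply exp_pos).
      apply ln_le. apply Rmult_lt_0_compat; auto; apply exp_pos.
      apply Rle_trans with (exp M * e0).
      apply Rmult_le_compat_l. apply Rlt_le, exp_pos. lra.
      unfold e0. replace (exp M * (b / 2 * exp (- M))) with (b / 2 * (exp M * exp (- M))) by ring.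
      rewrite <- exp_plus, Rplus_opp_r, exp_0. lra.
    - rewrite <- (is_RInt_unique _ _ _ _ (is_RInt_log e (asin s) He (proj1 A0))).
      apply RInt_le. lra. eexists; apply is_RInt_log; lra.
      apply ex_RInt_cont; intros; apply inv_radical_continuous; lra.
      intros t Ht. apply Rinv_le_contravar. apply radical_pos; lra.
      unfold radical. rewrite <- (sqrt_square (e + t)) by lra. apply sqrt_le_1_alt.
      rewrite speed_sq_sin. assert (0 <= sin t <= t).
      { split. apply sin_ge_0; lra. apply Rlt_le, sin_lt_x; lra. }
      assert (sin t * sin t <= t * t) by nra.
      assert (0 <= sin t * sin t) by nra. assert (0 < b * b < 1) by nra. nra. }
  assert (G2 : gint b s (PI / 2) - gint b s (asin s) <= 2 / (b / 2 * k)).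
  { unfold gint. rewrite <- (RInt_as_primitive (fun t => / radical b s t) (asin s) (PI / 2))
      by (intros; apply inv_radical_continuous; lra).
    apply Rle_trans with (/ (b / 2 * k) * (PI / 2 - asin s)).
    - apply RInt_le_const. lra. intros; apply inv_radical_continuous; lra.
      intros t Ht. apply Rinv_le_contravar. nra.
      assert (HK : k * k = 1 - b * b) by (apply sqrt_sqrt; nra).
      unfold radical. rewrite <- (sqrt_square (b / 2 * k)) by nra. apply sqrt_le_1_alt.
      eapply Rle_trans; [|apply radical_sq_beyond; lra].
      assert (S := sin_sub_sq (asin s) t ltac:(lra) ltac:(lra)). rewrite sin_asin in S by lra.
      assert (b / 2 * (b / 2) <= sin t * sin t) by nra.
      assert (1 - b * b <= 1 - s * s) by nra. assert (0 < 1 - b * b) by nra.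
      replace (b / 2 * k * (b / 2 * k)) with ((k * k) * (b / 2 * (b / 2))) by ring. rewrite HK.
      apply Rmult_le_compat; nra.
    - unfold Rdiv at 3. rewrite Rmult_comm. apply Rmult_le_compat_r. apply Rlt_le, Rinv_0_lt_compat; nra. lra. }
  assert (E : (q - 2 * p) * M = 2 * p * (2 / (b / 2 * k))) by (unfold M; field; repeat split; lra).
  nra.
Qed.

Lemma interior_minimum p q b : 0 < p -> 2 * p < q -> 0 < b < 1 ->
  exists s, 0 < s < b /\ (forall s', 0 <= s' <= b -> closed_length p q b s <= closed_length p q b s') /\
    q * gint b s (asin s) = 2 * p * gint b s (PI / 2).
Proof.
  intros Hp Hq Hb.
  (* Clamping the argument to [[0, b]] gives the two-sided continuity at the end points that the
     extreme value theorem and the mean value theorem ask for. *)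
  assert (C : forall s, 0 <= s <= b -> continuity_pt (fun u => closed_length p q b (Rmax 0 (Rmin u b))) s).
  { intros s Hs eps He.
    destruct (closed_length_continuous p q b s b ltac:(lra) ltac:(lra) ltac:(lra) Hs ltac:(lra) eps He) as [d [Hd H]].
    exists d. split; auto. intros u [_ Hu]. simpl in *. unfold R_dist in *.
    rewrite (Rmin_left s), (Rmax_right 0 s) by lra. apply H.
    - unfold Rmax, Rmin. destruct (Rle_dec u b); destruct Rle_dec; lra.
    - eapply Rle_lt_trans; [|apply Hu].
      unfold Rmax, Rmin, Rabs. destruct (Rle_dec u b); destruct Rle_dec; repeat destruct Rcase_abs; lra. }
  assert (Cl : forall s, 0 <= s <= b -> Rmax 0 (Rmin s b) = s).
  { intros s Hs. rewrite Rmin_left, Rmax_right; lra. }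
  destruct (continuity_ab_min _ 0 b ltac:(lra) C) as [m [Hm Hm']].
  assert (Hmin : forall s', 0 <= s' <= b -> closed_length p q b m <= closed_length p q b s').
  { intros s' Hs'. specialize (Hm s' Hs'). cbv beta in Hm. now rewrite !Cl in Hm. }
  set (df := fun s => 2 * s * (q * gint b s (asin s) - 2 * p * gint b s (PI / 2))).
  (* The derivative is known only in the open interval, while the intermediate point may be reported
     at an end. Declaring the slope to be 0 there produces the case [l = 0], in which the two
     lengths coincide. *)
  assert (MV : forall x y, 0 <= x < y -> y <= b -> exists l,
    closed_length p q b y - closed_length p q b x = l * (y - x) /\ (l = 0 \/ exists z, x < z < y /\ l = df z)).
  { intros x y Hx Hy.
    destruct (MVT_gen (fun u => closed_length p q b (Rmax 0 (Rmin u b))) x y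
      (fun z => if Rlt_dec x z then if Rlt_dec z y then df z else 0 else 0)) as [c [Hc E]].
    - rewrite Rmin_left, Rmax_right by lra. intros z Hz.
      destruct (Rlt_dec x z); [|lra]. destruct (Rlt_dec z y); [|lra].
      apply (is_derive_ext_loc (closed_length p q b)).
      + assert (Hd' : 0 < Rmin (z - x) (y - z)) by (apply Rmin_pos; lra).
        exists (mkposreal _ Hd'). intros u Hu. change (Rabs (u - z) < Rmin (z - x) (y - z)) in Hu.
        assert (D1 := Rmin_l (z - x) (y - z)). assert (D2 := Rmin_r (z - x) (y - z)).
        apply Rabs_lt_between in Hu. rewrite Cl; lra.
      + apply closed_length_derive; lra.
    - rewrite Rmin_left, Rmax_right by lra. intros z Hz. apply C. lra.
    - rewrite !Cl in E by lra. eexists. split. exact E.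
      destruct (Rlt_dec x c); [|auto]. destruct (Rlt_dec c y); [|auto].
      right. exists c. auto. }
  (* The derivative is negative near [0] and positive near [b], so a minimum attained at an
     end is also attained inside. *)
  assert (I : exists s, 0 < s < b /\ closed_length p q b s <= closed_length p q b m).
  { destruct (Req_dec m 0) as [->|N0]; [|destruct (Req_dec m b) as [->|Nb]].
    - destruct (rotation_small p q b) as [s0 [Hs0 H]]; try lra.
      exists s0. split; auto. destruct (MV 0 s0) as [l [El [->|[z [Hz ->]]]]]; try lra.
      specialize (H z ltac:(lra)). unfold df in El. assert (0 <= z * s0) by nra. nra.
    - destruct (rotation_large p q b) as [s0 [Hs0 H]]; try lra.
      exists s0. split; auto. destruct (MV s0 b) as [l [El [->|[z [Hz ->]]]]]; try lra.
      specialize (H z ltac:(lra)). unfold df in El. assert (0 <= z * (b - s0)) by nra. nra.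
    - exists m. split; lra. }
  destruct I as [s [Hs Hsm]]. exists s. split; auto.
  assert (Hmin' : forall s', 0 <= s' <= b -> closed_length p q b s <= closed_length p q b s').
  { intros s' Hs'. eapply Rle_trans. apply Hsm. auto. }
  split; auto.
  assert (D := closed_length_derive p q b s Hs ltac:(lra)).
  assert (pr : derivable_pt (closed_length p q b) s) by (eexists; apply is_derive_Reals, D).
  assert (Z := deriv_minimum (closed_length p q b) 0 b s pr (proj1 Hs) (proj2 Hs)
    (fun x H1 H2 => Hmin' x (conj (Rlt_le _ _ H1) (Rlt_le _ _ H2)))).
  rewrite (derive_pt_eq_0 _ _ _ pr (proj1 (is_derive_Reals _ _ _) D)) in Z.
  assert (q * gint b s (asin s) - 2 * p * gint b s (PI / 2) = 0); [|lra].
  apply Rmult_integral in Z. destruct Z; lra.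
Qed.

(** * Explicit bounds on the length *)

Lemma RInt_le_derive (f F g : R -> R) (a b : R) : a <= b -> (forall x, continuous f x) ->
  (forall x, is_derive F x (g x)) -> (forall x, continuous g x) ->
  (forall x, a <= x <= b -> f x <= g x) -> RInt f a b <= F b - F a.
Proof.
  intros Hab Hf HF Hg H.
  rewrite <- (is_RInt_unique g a b (F b - F a)).
  - apply RInt_le; auto using ex_RInt_cont. intros; apply H; lra.
  - apply (is_RInt_derive (V := R_CompleteNormedModule) F g); auto.
Qed.

Lemma RInt_ge_derive (f F g : R -> R) (a b : R) : a <= b -> (forall x, continuous f x) ->
  (forall x, is_derive F x (g x)) -> (forall x, continuous g x) ->
  (forall x, a <= x <= b -> g x <= f x) -> F b - F a <= RInt f a b.
Proof.
  intros Hab Hf HF Hg H.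
  rewrite <- (is_RInt_unique g a b (F b - F a)).
  - apply RInt_le; auto using ex_RInt_cont. intros; apply H; lra.
  - apply (is_RInt_derive (V := R_CompleteNormedModule) F g); auto.
Qed.

(** On the arc the radicand is [b * b * (cos t * cos t) - v] with [v = s * s - sin t * sin t]. Its
    root lies below the linearization [cos t * (b - v / (2 * b))], whose integral falls short of
    [b * s] by [s * s * s / (3 * b)]. *)
Lemma excess_lower b s : 0 <= s <= b -> 0 < b < 1 ->
  2 / 3 * (s * s * s) <= 2 * b * s - 2 * kint b s (asin s).
Proof.
  intros Hs Hb. assert (A := asin_pos s ltac:(lra)). assert (P2 := PI2_bounds).
  assert (W : sin (asin s) = s) by (apply sin_asin; lra).
  assert (H : kint b s (asin s) <=
    (b * sin (asin s) - (s * s * sin (asin s) - sin (asin s) ^ 3 / 3) / (2 * b))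
    - (b * sin 0 - (s * s * sin 0 - sin 0 ^ 3 / 3) / (2 * b))).
  { apply (RInt_le_derive _ (fun t => b * sin t - (s * s * sin t - sin t ^ 3 / 3) / (2 * b))
      (fun t => b * cos t - (s * s - sin t * sin t) * cos t / (2 * b))).
    - lra.
    - apply radical_continuous.
    - intros x. auto_derive. auto. field. lra.
    - intros x. apply (ex_derive_continuous (V := R_NormedModule)). auto_derive. auto.
    - intros t Ht.
      assert (S := sin_sub_sq t (asin s) ltac:(lra) ltac:(lra)). rewrite W in S.
      assert (Hc : 0 <= cos t <= 1). { split. apply cos_ge_0; lra. apply COS_bound. }
      set (v := s * s - sin t * sin t).
      assert (Hv : 0 <= v <= b * b) by (unfold v; nra).
      replace (b * cos t - v * cos t / (2 * b)) with (cos t * (b - v / (2 * b))) by (field; lra).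
      assert (0 <= b - v / (2 * b)).
      { apply Rmult_le_reg_r with (2 * b). lra. field_simplify; nra. }
      rewrite <- (sqrt_square (cos t * (b - v / (2 * b)))) by nra.
      apply sqrt_le_1_alt.
      replace (speed_sq b t - s * s) with (b * b * (cos t * cos t) - v) by (unfold speed_sq, v; ring).
      replace (cos t * (b - v / (2 * b)) * (cos t * (b - v / (2 * b))))
        with (b * b * (cos t * cos t) - v * (cos t * cos t) + (cos t * (v / (2 * b))) * (cos t * (v / (2 * b)))) by (field; lra).
      assert (v * (cos t * cos t) <= v * 1) by (apply Rmult_le_compat_l; nra).
      generalize (Rle_0_sqr (cos t * (v / (2 * b)))). unfold Rsqr. lra. }
  rewrite W, sin_0 in H.
  replace (b * s - (s * s * s - s ^ 3 / 3) / (2 * b) - (b * 0 - (s * s * 0 - 0 ^ 3 / 3) / (2 * b)))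
    with (b * s - s * s * s * (1 / (3 * b))) in H by (field; lra).
  assert (1 / 3 <= 1 / (3 * b)).
  { unfold Rdiv. rewrite !Rmult_1_l. apply Rinv_le_contravar; lra. }
  assert (0 <= s * s * s) by (repeat apply Rmult_le_pos; lra). nra.
Qed.

Lemma kint_between b s : kint b s (PI / 2) - kint b s (asin s) = RInt (radical b s) (asin s) (PI / 2).
Proof. unfold kint. symmetry. apply RInt_as_primitive, radical_continuous. Qed.

(** The right side is half of [closed_length 1 2 b s]; the bound says that this length is at least
    that of the major axis run back and forth. Beyond [asin s], [radical] dominates
    [cos (asin s) * sin t], whose integral is [1 - s * s], and [b * s >= s * s] makes up the
    rest. *)
Lemma string_lower b s : 0 <= s <= b -> 0 < b < 1 ->
  2 <= 2 * b * s - 2 * kint b s (asin s) + 2 * kint b s (PI / 2).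
Proof.
  intros Hs Hb. assert (A := asin_pos s ltac:(lra)). assert (P2 := PI2_bounds).
  assert (HC := cos_asin_sq s ltac:(lra)). assert (HC' := cos_asin_pos s ltac:(lra)).
  assert (H : - cos (asin s) * cos (PI / 2) - - cos (asin s) * cos (asin s)
    <= RInt (radical b s) (asin s) (PI / 2)).
  { apply (RInt_ge_derive _ (fun t => - cos (asin s) * cos t) (fun t => cos (asin s) * sin t)).
    - lra.
    - apply radical_continuous.
    - intros x. auto_derive. auto. ring.
    - intros x. apply (ex_derive_continuous (V := R_NormedModule)). auto_derive. auto.
    - intros t Ht. assert (0 <= sin t) by (apply sin_ge_0; lra).
      rewrite <- (sqrt_square (cos (asin s) * sin t)) by nra. apply sqrt_le_1_alt.
      replace (cos (asin s) * sin t * (cos (asin s) * sin t))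
        with ((cos (asin s) * cos (asin s)) * (sin t * sin t)) by ring.
      rewrite HC. apply radical_sq_beyond; lra. }
  rewrite <- kint_between, cos_PI2 in H. nra.
Qed.

(** At [s = b] the minorant used for [string_lower] coincides with [radical], so the bound 2 is
    attained. *)
Lemma string_upper_focal b : 0 < b < 1 ->
  2 * b * b - 2 * kint b b (asin b) + 2 * kint b b (PI / 2) <= 2.
Proof.
  intros Hb. assert (A := asin_pos b ltac:(lra)). assert (P2 := PI2_bounds).
  assert (HC := cos_asin_sq b ltac:(lra)). assert (HC' := cos_asin_pos b ltac:(lra)).
  assert (H : RInt (radical b b) (asin b) (PI / 2) <=
     - cos (asin b) * cos (PI / 2) - - cos (asin b) * cos (asin b)).
  { apply (RInt_le_derive _ (fun t => - cos (asin b) * cos t) (fun t => cos (asin b) * sin t)).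
    - lra.
    - apply radical_continuous.
    - intros x. auto_derive. auto. ring.
    - intros x. apply (ex_derive_continuous (V := R_NormedModule)). auto_derive. auto.
    - intros t Ht. assert (0 <= sin t) by (apply sin_ge_0; lra).
      rewrite <- (sqrt_square (cos (asin b) * sin t)) by nra. apply sqrt_le_1_alt.
      replace (cos (asin b) * sin t * (cos (asin b) * sin t))
        with ((cos (asin b) * cos (asin b)) * (sin t * sin t)) by ring.
      rewrite HC, speed_sq_sin. lra. }
  rewrite <- kint_between, cos_PI2 in H. nra.
Qed.

Lemma kint_pos b s x : 0 <= x -> 0 <= kint b s x.
Proof.
  intros Hx. replace 0 with (0 * (x - 0)) by ring. apply RInt_ge_const; auto.
  apply radical_continuous. intros; apply sqrt_pos.
Qed.

Lemma kint_quarter_le b s : kint b s (PI / 2) <= kint b 0 (PI / 2).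
Proof.
  assert (P2 := PI2_bounds).
  apply RInt_le; try (apply ex_RInt_cont, radical_continuous). lra.
  intros t _. apply sqrt_le_1_alt. nra.
Qed.

Lemma kint_quarter_ge b s : 0 <= s -> kint b 0 (PI / 2) - 2 * s <= kint b s (PI / 2).
Proof.
  intros Hs. assert (P2 := PI2_bounds).
  assert (H : Rabs (kint b 0 (PI / 2) - kint b s (PI / 2)) <= (PI / 2 - 0) * s).
  { apply RInt_le_abs; try apply radical_continuous. lra.
    intros t _. eapply Rle_trans. apply sqrt_diff_le.
    replace (speed_sq b t - 0 * 0 - (speed_sq b t - s * s)) with (s * s) by ring.
    rewrite Rabs_pos_eq, sqrt_square; nra. }
  apply Rabs_le_between in H. nra.
Qed.

Lemma kint_quarter_increasing b b' : 0 < b < b' -> kint b 0 (PI / 2) < kint b' 0 (PI / 2).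
Proof.
  intros Hb. assert (P2 := PI2_bounds).
  apply RInt_lt; try (intros; apply radical_continuous). lra.
  intros t Ht. assert (Hc : 0 < cos t) by (apply cos_gt_0; lra).
  assert (b * b < b' * b') by nra. assert (0 < cos t * cos t) by nra.
  apply sqrt_lt_1_alt. unfold speed_sq. split; nra.
Qed.

Lemma closed_length_0 p q b : closed_length p q b 0 = 4 * p * kint b 0 (PI / 2).
Proof. unfold closed_length. rewrite asin_0, kint_0. ring. Qed.

(** The length is split into [q - 2 * p] excess terms, each at most [2 * b * b <= 2], and [2 * p]
    string terms, each at most 2. *)
Lemma closed_length_focal p q b : 0 <= p -> 2 * p <= q -> 0 < b < 1 -> closed_length p q b b <= 2 * q.
Proof.
  intros Hp Hq Hb. assert (H := string_upper_focal b Hb).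
  assert (K := kint_pos b b (asin b) (proj1 (asin_pos b ltac:(lra)))).
  unfold closed_length. set (k := kint b b (asin b)) in *. set (k' := kint b b (PI / 2)) in *.
  replace (q * (2 * b * b - 2 * k) + 4 * p * k')
    with ((q - 2 * p) * (2 * b * b - 2 * k) + 2 * p * (2 * b * b - 2 * k + 2 * k')) by ring.
  assert (b * b <= 1) by nra.
  assert ((q - 2 * p) * (2 * b * b - 2 * k) <= (q - 2 * p) * 2) by (apply Rmult_le_compat_l; lra).
  assert (2 * p * (2 * b * b - 2 * k + 2 * k') <= 2 * p * 2) by (apply Rmult_le_compat_l; lra).
  lra.
Qed.

(** Regrouped as [q] string terms, each at least 2, minus [2 * (q - 2 * p)] quarter integrals, which
    are largest at [s = 0], where each is a quarter of the perimeter. For [q = 2 * p + 1] the loss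
    is half a perimeter. *)
Lemma closed_length_lower_half p q b s : 0 <= p -> 2 * p <= q -> 0 < b < 1 -> 0 <= s <= b ->
  2 * q - 2 * (q - 2 * p) * kint b 0 (PI / 2) <= closed_length p q b s.
Proof.
  intros Hp Hq Hb Hs. assert (H := string_lower b s Hs Hb). assert (K := kint_quarter_le b s).
  unfold closed_length. set (k := kint b s (asin s)) in *. set (k' := kint b s (PI / 2)) in *.
  replace (q * (2 * b * s - 2 * k) + 4 * p * k')
    with (q * (2 * b * s - 2 * k + 2 * k') - 2 * (q - 2 * p) * k') by ring.
  assert (q * 2 <= q * (2 * b * s - 2 * k + 2 * k')) by (apply Rmult_le_compat_l; lra).
  assert (2 * (q - 2 * p) * k' <= 2 * (q - 2 * p) * kint b 0 (PI / 2)) by (apply Rmult_le_compat_l; lra).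
  lra.
Qed.

(** Compared with [p] perimeters, at most [8 * p * s] is lost and at least
    [q * (2 / 3 * (s * s * s))] is gained. For [s < s0] the loss is below [g]; for [s >= s0] the
    gain prevails once [q * (s * s) > 12 * p]. The threshold is therefore uniform in [s]. *)
Lemma closed_length_lower_perimeter p b g : 0 < p -> 0 < b < 1 -> 0 < g ->
  exists q0, forall q s, q0 <= q -> 0 <= s <= b -> 4 * p * kint b 0 (PI / 2) - g < closed_length p q b s.
Proof.
  intros Hp Hb Hg. set (s0 := g / (8 * p)).
  assert (H0 : 0 < s0) by (apply Rdiv_lt_0_compat; lra).
  assert (E0 : 8 * p * s0 = g) by (unfold s0; field; lra).
  exists (12 * p / (s0 * s0) + 1). intros q s Hq Hs.
  assert (Hq0 : 0 < 12 * p / (s0 * s0)) by (apply Rdiv_lt_0_compat; nra).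
  assert (H := excess_lower b s Hs Hb). assert (K := kint_quarter_ge b s (proj1 Hs)).
  unfold closed_length. assert (Hsss : 0 <= s * s * s) by (repeat apply Rmult_le_pos; lra).
  assert (H1 : q * (2 / 3 * (s * s * s)) <= q * (2 * b * s - 2 * kint b s (asin s)))
    by (apply Rmult_le_compat_l; lra).
  assert (H2 : 4 * p * (kint b 0 (PI / 2) - 2 * s) <= 4 * p * kint b s (PI / 2))
    by (apply Rmult_le_compat_l; lra).
  assert (H3 : 8 * p * s - q * (2 / 3 * (s * s * s)) < g); [|lra].
  destruct (Rlt_le_dec s s0) as [C|C].
  - assert (0 <= q * (2 / 3 * (s * s * s))) by (apply Rmult_le_pos; lra). nra.
  - assert (H4 : 12 * p < q * (s * s)).
    { apply Rlt_le_trans with (q * (s0 * s0)).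
      - assert (12 * p / (s0 * s0) * (s0 * s0) = 12 * p) by (field; lra). nra.
      - apply Rmult_le_compat_l; nra. }
    replace (q * (2 / 3 * (s * s * s))) with (2 / 3 * s * (q * (s * s))) by ring. nra.
Qed.

(** * The minimal length as a function of the ellipse *)

(** Taking an infimum avoids selecting a minimizer for each [b]; [min_length_spec] shows that it is
    attained at a closed caustic. *)
Definition min_length (p q b : R) : R :=
  real (Glb_Rbar (fun y => exists s, 0 <= s <= b /\ y = closed_length p q b s)).

Lemma min_length_spec p q b : 0 < p -> 2 * p < q -> 0 < b < 1 ->
  exists s, 0 < s < b /\ min_length p q b = closed_length p q b s /\
    q * gint b s (asin s) = 2 * p * gint b s (PI / 2) /\
    (forall s', 0 <= s' <= b -> min_length p q b <= closed_length p q b s').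
Proof.
  intros Hp Hq Hb. destruct (interior_minimum p q b Hp Hq Hb) as [s [Hs [Hm Hc]]].
  assert (E : min_length p q b = closed_length p q b s).
  { unfold min_length. rewrite (is_glb_Rbar_unique _ (Finite (closed_length p q b s))). reflexivity.
    split.
    - intros y [s' [Hs' ->]]. simpl. auto.
    - intros y Hy. apply Hy. exists s. split; auto. lra. }
  exists s. rewrite E. auto.
Qed.

(** A minimizer [s] for the ellipse [a'] becomes the competitor [s / a' * a] for the ellipse [a]. It
    lies in the admissible interval and has moved by at most [Rabs (a - a')], so the joint modulus
    of [closed_length] bounds one minimum by the other, in both directions. *)
Lemma min_length_continuous p q b : 0 < p -> 2 * p < q -> 0 < b < 1 -> continuity_pt (min_length p q) b.
Proof.
  intros Hp Hq Hb eps He.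
  destruct (closed_length_modulus p q ((1 + b) / 2) ltac:(lra) ltac:(lra) ltac:(lra)) as [C [HC H]].
  set (x := eps / (C + 1)). assert (Hx : 0 < x) by (apply Rdiv_lt_0_compat; lra).
  assert (Ex : x * (C + 1) = eps) by (unfold x; field; lra).
  assert (L : forall a a', 0 < a <= (1 + b) / 2 -> 0 < a' <= (1 + b) / 2 ->
    Rabs (a - a') <= 1 -> min_length p q a <= min_length p q a' + C * sqrt (Rabs (a - a'))).
  { intros a a' Ha Ha' Hd.
    destruct (min_length_spec p q a Hp Hq ltac:(lra)) as [_ [_ [_ [_ M]]]].
    destruct (min_length_spec p q a' Hp Hq ltac:(lra)) as [s [Hs [-> _]]].
    assert (0 <= s / a' <= 1).
    { split. apply Rlt_le, Rdiv_lt_0_compat; lra. apply Rmult_le_reg_r with a'. lra. field_simplify; lra. }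
    assert (Es : s = s / a' * a') by (field; lra).
    assert (0 <= s / a' * a <= a) by nra.
    specialize (M (s / a' * a) ltac:(lra)).
    assert (Z := H a a' (s / a' * a) s (Rabs (a - a')) ltac:(lra) ltac:(lra) ltac:(lra) ltac:(lra)
      ltac:(lra)). 
    assert (Hss : Rabs (s / a' * a - s) <= Rabs (a - a')).
    { rewrite Es at 2. rewrite <- Rmult_minus_distr_l, Rabs_mult, (Rabs_pos_eq (s / a')) by lra.
      generalize (Rabs_pos (a - a')). nra. }
    specialize (Z Hss Hd). apply Rabs_le_between in Z. lra. }
  set (d := Rmin 1 (Rmin (x * x) (Rmin b ((1 - b) / 2)))).
  assert (D1 : d <= 1) by apply Rmin_l.
  assert (D2 : d <= x * x /\ d <= b /\ d <= (1 - b) / 2).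
  { unfold d. repeat split.
    eapply Rle_trans; [apply Rmin_r|apply Rmin_l].
    eapply Rle_trans; [apply Rmin_r|]. eapply Rle_trans; [apply Rmin_r|apply Rmin_l].
    eapply Rle_trans; [apply Rmin_r|]. eapply Rle_trans; [apply Rmin_r|apply Rmin_r]. }
  exists d. split. unfold d. repeat apply Rmin_pos; try lra; nra.
  intros b' [_ Hd]. simpl in *. unfold R_dist in *.
  assert (Hd' := Hd). apply Rabs_lt_between in Hd'.
  assert (S : C * sqrt (Rabs (b' - b)) < eps).
  { assert (sqrt (Rabs (b' - b)) <= x).
    { rewrite <- (sqrt_square x) by lra. apply sqrt_le_1_alt. lra. } nra. }
  assert (L1 := L b' b ltac:(lra) ltac:(lra) ltac:(lra)).
  assert (L2 := L b b' ltac:(lra) ltac:(lra) ltac:(rewrite Rabs_minus_sym; lra)).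
  rewrite (Rabs_minus_sym b b') in L2.
  apply Rabs_lt_between. lra.
Qed.

(** * Choice of the two types and of the intermediate ellipse *)

Lemma archimedean_nat (x : R) : { k : nat | x < INR k }.
Proof.
  destruct (archimed x) as [H _]. exists (Z.to_nat (up x)).
  destruct (Z_le_gt_dec 0 (up x)).
  - rewrite INR_IZR_INZ, Z2Nat.id by lia. lra.
  - assert (IZR (up x) < 0) by (apply IZR_lt; lia). generalize (pos_INR (Z.to_nat (up x))). lra.
Qed.

(* [2 q'] is placed strictly between [p + 1/2] perimeters of the ellipse [b2] and [p] perimeters of the
   ellipse [b1], and [q] is then taken huge; [p = 1 mod n] makes every residue of [q] modulo [n]
   compatible with [q = 1 mod p], hence with coprimality. *)
Lemma choose_types (b1 b2 : R) (m n : Z) : 0 < b2 < b1 -> b1 < 1 -> n <> 0%Z ->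
  exists p q p' q' : nat,
    (0 < p)%nat /\ (2 * p < q)%nat /\ (0 < p')%nat /\ (2 * p' < q')%nat /\
    Z.gcd (Z.of_nat p) (Z.of_nat q) = 1%Z /\ Z.gcd (Z.of_nat p') (Z.of_nat q') = 1%Z /\
    (p * q' < p' * q)%nat /\
    (Z.of_nat q mod n = (Z.of_nat q' + m) mod n)%Z /\
    min_length (INR p) (INR q) b2 < min_length (INR p') (INR q') b2 /\
    min_length (INR p') (INR q') b1 < min_length (INR p) (INR q) b1.
Proof.
  intros Hb Hb1 Hn.
  set (A1 := kint b1 0 (PI / 2)). set (A2 := kint b2 0 (PI / 2)).
  assert (HA : A2 < A1) by (apply kint_quarter_increasing; lra).
  assert (HA2 : 0 <= A2) by (apply kint_pos; generalize PI2_bounds; lra).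
  set (N := Z.abs_nat n). assert (HN : (1 <= N)%nat) by (unfold N; lia).
  (* An odd [q'] is sought between [(2 * p + 1) * A2] and [2 * p * A1]. This gap has length
     [2 * p * (A1 - A2) - A2], and rounding up to an odd integer costs at most 3. *)
  destruct (archimedean_nat ((A2 + 3) / (2 * (A1 - A2)))) as [j Hj].
  set (p := (1 + N * j)%nat).
  assert (Hp : INR j <= INR p) by (apply le_INR; unfold p; nia).
  assert (Hpp : A2 + 3 < 2 * INR p * (A1 - A2)).
  { apply Rle_lt_trans with (2 * (A1 - A2) * ((A2 + 3) / (2 * (A1 - A2)))).
    right; field; lra. nra. }
  assert (Hp1 : 1 <= INR p) by (apply (le_INR 1); unfold p; lia).
  set (x := (2 * INR p + 1) * A2).
  assert (Hx : 0 <= x) by (apply Rmult_le_pos; lra).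
  destruct (archimed (x / 2)) as [U1 U2].
  assert (Hup : (0 < up (x / 2))%Z) by (apply lt_IZR; lra).
  set (p' := Z.to_nat (up (x / 2))).
  assert (Ep' : INR p' = IZR (up (x / 2))) by (unfold p'; rewrite INR_IZR_INZ, Z2Nat.id; auto; lia).
  assert (Hp' : (0 < p')%nat) by (unfold p'; lia).
  set (q' := (2 * p' + 1)%nat).
  assert (Eq' : INR q' = 2 * INR p' + 1) by (unfold q'; rewrite plus_INR, mult_INR; simpl; ring).
  assert (Hq1 : (2 * INR p + 1) * A2 < INR q') by (fold x; lra).
  assert (Hq2 : INR q' < 2 * INR p * A1) by (unfold x in *; nra).
  destruct (closed_length_lower_perimeter (INR p) b1 (4 * INR p * A1 - 2 * INR q') ltac:(lra) ltac:(lra) ltac:(lra))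
    as [q0 Hq0].
  destruct (archimedean_nat q0) as [T0 HT0].
  (* [T0] makes [q] large enough for the perimeter bound; [p * q'] makes the rotation number [p / q]
     smaller than [p' / q']. *)
  set (T := (T0 + p * q' + 1)%nat).
  (* The [- 1] offsets the 1 in [q = 1 + p * i]: with [i] congruent to [X] and [p] to 1 modulo [N],
     [q] is congruent to [q' + m]. *)
  set (X := (Z.of_nat q' + m - 1)%Z).
  set (r := (X mod Z.of_nat N)%Z).
  assert (Hr : (0 <= r < Z.of_nat N)%Z) by (apply Z.mod_pos_bound; lia).
  set (i := (Z.to_nat r + N * T)%nat).
  assert (Hi : (T <= i)%nat) by (unfold i; nia).
  set (q := (1 + p * i)%nat).
  assert (Hpn : (1 <= p)%nat) by (unfold p; lia).
  assert (HqT : (T < q)%nat) by (unfold q; nia).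
  exists p, q, p', q'.
  assert (Hpq : (2 * p < q)%nat) by (unfold q, T, q' in *; nia).
  assert (Hpq' : (2 * p' < q')%nat) by (unfold q'; lia).
  assert (Rpq : 2 * INR p < INR q) by (apply lt_INR in Hpq; rewrite mult_INR in Hpq; exact Hpq).
  assert (Rpp : 0 < INR p') by (apply (lt_INR 0); auto).
  split; [lia|]. split; [auto|]. split; [auto|]. split; [auto|].
  split; [|split; [|split; [|split; [|split]]]].
  - apply Z.bezout_1_gcd. exists (- Z.of_nat i)%Z, 1%Z. unfold q. lia.
  - apply Z.bezout_1_gcd. exists (- 2)%Z, 1%Z. unfold q'. lia.
  - unfold T in HqT. nia.
  - assert (En : exists e, Z.of_nat N = (e * n)%Z).
    { exists (Z.sgn n). unfold N. rewrite Zabs2Nat.id_abs. lia. }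
    destruct En as [e En].
    assert (Ei : Z.of_nat i = (r + Z.of_nat N * Z.of_nat T)%Z) by (unfold i; lia).
    assert (Eq : Z.of_nat q = (1 + (1 + Z.of_nat N * Z.of_nat j) * Z.of_nat i)%Z) by (unfold q, p; lia).
    assert (EX : X = (Z.of_nat N * (X / Z.of_nat N) + r)%Z) by (apply Z_div_mod_eq_full).
    replace (Z.of_nat q) with (Z.of_nat q' + m
      + (e * (Z.of_nat j * Z.of_nat i + Z.of_nat T - X / Z.of_nat N)) * n)%Z.
    apply Z_mod_plus_full.
    rewrite Eq. replace (Z.of_nat q' + m)%Z with (X + 1)%Z by (unfold X; ring).
    rewrite EX at 1.
    transitivity (Z.of_nat N * (X / Z.of_nat N) + r + 1 + (e * n) * (Z.of_nat j * Z.of_nat i + Z.of_nat T - X / Z.of_nat N))%Z.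
    ring. rewrite <- En. rewrite Ei. ring.
  - destruct (min_length_spec (INR p) (INR q) b2 ltac:(lra) Rpq ltac:(lra)) as [_ [_ [_ [_ M]]]].
    specialize (M 0 ltac:(lra)). rewrite closed_length_0 in M. fold A2 in M.
    destruct (min_length_spec (INR p') (INR q') b2 ltac:(lra) ltac:(lra) ltac:(lra)) as [s [Hs [-> _]]].
    assert (L := closed_length_lower_half (INR p') (INR q') b2 s ltac:(lra) ltac:(lra) ltac:(lra) ltac:(lra)).
    fold A2 in L. rewrite Eq' in L at 2. nra.
  - destruct (min_length_spec (INR p') (INR q') b1 ltac:(lra) ltac:(lra) ltac:(lra)) as [_ [_ [_ [_ M]]]].
    specialize (M b1 ltac:(lra)).
    assert (L := closed_length_focal (INR p') (INR q') b1 ltac:(lra) ltac:(lra) ltac:(lra)).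
    destruct (min_length_spec (INR p) (INR q) b1 ltac:(lra) Rpq ltac:(lra)) as [s [Hs [-> _]]].
    specialize (Hq0 (INR q) s). fold A1 in Hq0.
    assert (INR T0 <= INR q) by (apply le_INR; unfold T in *; lia).
    specialize (Hq0 ltac:(lra) ltac:(lra)). lra.
Qed.

Lemma equal_closed_lengths (b1 b2 : R) (m n : Z) : 0 < b2 < b1 -> b1 < 1 -> n <> 0%Z ->
  exists (b s s' : R) (p q p' q' : nat), b2 <= b <= b1 /\ 0 < s < b /\ 0 < s' < b /\
    (0 < p)%nat /\ (2 * p < q)%nat /\ (0 < p')%nat /\ (2 * p' < q')%nat /\
    Z.gcd (Z.of_nat p) (Z.of_nat q) = 1%Z /\ Z.gcd (Z.of_nat p') (Z.of_nat q') = 1%Z /\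
    (p * q' < p' * q)%nat /\
    (Z.of_nat q mod n = (Z.of_nat q' + m) mod n)%Z /\
    INR q * gint b s (asin s) = 2 * INR p * gint b s (PI / 2) /\
    INR q' * gint b s' (asin s') = 2 * INR p' * gint b s' (PI / 2) /\
    closed_length (INR p) (INR q) b s = closed_length (INR p') (INR q') b s'.
Proof.
  intros Hb Hb1 Hn.
  destruct (choose_types b1 b2 m n Hb Hb1 Hn) as (p & q & p' & q' & H1 & H2 & H3 & H4 & H5 & H6 & H7 & H8 & H9 & H10).
  assert (R1 : 0 < INR p) by (apply (lt_INR 0); auto).
  assert (R2 : 2 * INR p < INR q) by (apply lt_INR in H2; rewrite mult_INR in H2; exact H2).
  assert (R3 : 0 < INR p') by (apply (lt_INR 0); auto).
  assert (R4 : 2 * INR p' < INR q') by (apply lt_INR in H4; rewrite mult_INR in H4; exact H4).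
  destruct (Ranalysis5.IVT_interv (fun b => min_length (INR p) (INR q) b - min_length (INR p') (INR q') b) b2 b1)
    as [b [Hbb Z]]; try lra.
  - intros a Ha. apply continuity_pt_minus; apply min_length_continuous; lra.
  - destruct (min_length_spec (INR p) (INR q) b) as [s [Hs [E [C _]]]]; try lra.
    destruct (min_length_spec (INR p') (INR q') b) as [s' [Hs' [E' [C' _]]]]; try lra.
    exists b, s, s', p, q, p', q'. repeat (split; [solve [auto | lra]|]). lra.
Qed.

(** * Invariance under similarities *)

(** The linear part has columns [(a, g)] and [e] times [(- g, a)], so [k] is the ratio and the sign
    [e] the orientation. *)
Record sim := Sim {
  sim_x : R; sim_y : R; sim_a : R; sim_g : R; sim_e : R; sim_k : R;
  sim_sign : sim_e * sim_e = 1;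
  sim_norm : sim_a * sim_a + sim_g * sim_g = sim_k * sim_k;
  sim_pos : 0 < sim_k }.

Definition sim_lin (M : sim) (v : point) : point :=
  (sim_a M * fst v - sim_e M * sim_g M * snd v, sim_g M * fst v + sim_e M * sim_a M * snd v).
Definition sim_app (M : sim) (P : point) : point :=
  (sim_x M + fst (sim_lin M P), sim_y M + snd (sim_lin M P)).

(** Since inverses are again similarities, each notion needs to be transported in one direction
    only. *)
Lemma sim_inverse (M : sim) : exists N : sim,
  (forall P, sim_app M (sim_app N P) = P) /\ (forall P, sim_app N (sim_app M P) = P).
Proof.
  destruct M as [x y a g e k He Hk Hp].
  set (i := / k * / k).
  assert (Hi : i * (a * a) = 1 - i * (g * g)).
  { enough (i * (a * a + g * g) = 1) by lra. rewrite Hk. unfold i. field. lra. }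
  assert (H1 : (a * i) * (a * i) + - (e * g * i) * - (e * g * i) = i).
  { transitivity (i * (i * (a * a) + (e * e) * (i * (g * g)))). ring. rewrite He, Hi. ring. }
  exists (Sim (- (a * x + g * y) * i) (- (- e * g * x + e * a * y) * i) (a * i) (- (e * g * i)) e (/ k) He H1
     (Rinv_0_lt_compat _ Hp)).
  assert (G1 : i * a * a = 1 - i * g * g) by lra.
  split; intros [u v]; unfold sim_app, sim_lin; simpl; apply f_equal2; ring [He G1].
Qed.

Section Transport.
Variable M : sim.

Lemma vec_sim_app P Q : vec (sim_app M P) (sim_app M Q) = sim_lin M (vec P Q).
Proof. unfold vec, sim_app, sim_lin. simpl. f_equal; ring. Qed.

Lemma dot_sim_lin u v : dot (sim_lin M u) (sim_lin M v) = sim_k M * sim_k M * dot u v.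
Proof.
  rewrite <- sim_norm. unfold dot, sim_lin. simpl.
  transitivity (sim_a M * sim_a M * (fst u * fst v + sim_e M * sim_e M * (snd u * snd v))
   + sim_g M * sim_g M * (fst u * fst v + sim_e M * sim_e M * (snd u * snd v))). ring.
  rewrite sim_sign. ring.
Qed.

Lemma cross_sim_lin u v : cross (sim_lin M u) (sim_lin M v) = sim_e M * (sim_k M * sim_k M) * cross u v.
Proof. rewrite <- sim_norm. unfold cross, sim_lin. simpl. ring. Qed.

Lemma edist_dot P Q : edist P Q = sqrt (dot (vec P Q) (vec P Q)).
Proof. unfold edist, dist_euc, dot, vec, Rsqr. simpl. f_equal. ring. Qed.

Lemma edist_sim_app P Q : edist (sim_app M P) (sim_app M Q) = sim_k M * edist P Q.
Proof.
  assert (K := sim_pos M).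
  rewrite !edist_dot, vec_sim_app, dot_sim_lin, sqrt_mult, sqrt_square; try nra.
  unfold dot. nra.
Qed.

Lemma sim_app_inj P Q : sim_app M P = sim_app M Q -> P = Q.
Proof.
  intros H. destruct (sim_inverse M) as (N & _ & NM). now rewrite <- (NM P), <- (NM Q), H.
Qed.

Lemma sim_lin_neq_0 v : v <> (0, 0) -> sim_lin M v <> (0, 0).
Proof.
  intros Hv H. apply Hv. assert (D := dot_sim_lin v v). rewrite H in D.
  assert (K := sim_pos M). unfold dot in D. simpl in D.
  assert (0 < sim_k M * sim_k M) by nra.
  assert (Z : fst v * fst v + snd v * snd v = 0) by nra.
  destruct v as [x y]. simpl in *. f_equal; nra.
Qed.

Lemma continuous_sim_lin (f : R -> point) (t : R) :
  continuous f t -> continuous (fun s => sim_lin M (f s)) t.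
Proof.
  intros Hf.
  assert (H1 : continuous (fun s => fst (f s)) t).
  { apply (continuous_comp f fst); auto. apply continuous_fst. }
  assert (H2 : continuous (fun s => snd (f s)) t).
  { apply (continuous_comp f snd); auto. apply continuous_snd. }
  apply (continuous_comp_2 (fun s => sim_a M * fst (f s) - sim_e M * sim_g M * snd (f s))
   (fun s => sim_g M * fst (f s) + sim_e M * sim_a M * snd (f s)) (fun x y => (x, y))).
  - apply (continuous_minus (V := R_NormedModule));
      apply (continuous_scal_r (V := R_NormedModule)); auto.
  - apply (continuous_plus (V := R_NormedModule));
      apply (continuous_scal_r (V := R_NormedModule)); auto.
  - apply continuous_ext with (f := fun x => x). intros []; reflexivity. apply continuous_id.
Qed.

Lemma continuous_sim_app P : continuous (sim_app M) P.
Proof.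
  assert (H1 : continuous (fst : point -> R) P) by apply continuous_fst.
  assert (H2 : continuous (snd : point -> R) P) by apply continuous_snd.
  apply (continuous_comp_2 (fun P => sim_x M + (sim_a M * fst P - sim_e M * sim_g M * snd P))
   (fun P => sim_y M + (sim_g M * fst P + sim_e M * sim_a M * snd P)) (fun x y => (x, y))).
  - apply (continuous_plus (V := R_NormedModule)). apply continuous_const.
    apply (continuous_minus (V := R_NormedModule));
      apply (continuous_scal_r (V := R_NormedModule)); auto.
  - apply (continuous_plus (V := R_NormedModule)). apply continuous_const.
    apply (continuous_plus (V := R_NormedModule));
      apply (continuous_scal_r (V := R_NormedModule)); auto.
  - apply continuous_ext with (f := fun x => x). intros []; reflexivity. apply continuous_id.
Qed.

Definition related (G G' : point -> Prop) := forall P, G' (sim_app M P) <-> G P.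

Lemma locally_app (G G' : point -> Prop) P : related G G' ->
  locally (sim_app M P) G' -> locally P G.
Proof.
  intros HG H. generalize (continuous_sim_app P G' H). unfold filtermap.
  apply filter_imp. intros Q. apply HG.
Qed.

Lemma boundary_app (G G' : point -> Prop) P : related G G' ->
  boundary G P -> boundary G' (sim_app M P).
Proof.
  intros HG [H1 H2]. split; intros H.
  - apply H1. now apply (locally_app G G').
  - apply H2. apply (locally_app (fun Q => ~ G Q) (fun Q => ~ G' Q)); auto.
    intros Q. rewrite (HG Q). tauto.
Qed.

Lemma velocity_app (c : R -> point) t :
  ex_derive (fun s => fst (c s)) t /\ ex_derive (fun s => snd (c s)) t ->
  is_derive (fun s => fst (sim_app M (c s))) t (fst (sim_lin M (velocity c t))) /\
  is_derive (fun s => snd (sim_app M (c s))) t (snd (sim_lin M (velocity c t))).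
Proof.
  intros [H1 H2]. apply Derive_correct in H1, H2.
  unfold sim_app, sim_lin, velocity. simpl. split.
  - eapply (is_derive_ext (fun s => (sim_x M + (sim_a M * fst (c s) + (- (sim_e M * sim_g M)) * snd (c s))))).
    intros u; change (sim_x M + (sim_a M * fst (c u) + - (sim_e M * sim_g M) * snd (c u)) =
      sim_x M + (sim_a M * fst (c u) - sim_e M * sim_g M * snd (c u)) :> R). ring.
    replace (sim_a M * Derive (fun s => fst (c s)) t - sim_e M * sim_g M * Derive (fun s => snd (c s)) t)
      with (0 + (sim_a M * Derive (fun s => fst (c s)) t + (- (sim_e M * sim_g M)) * Derive (fun s => snd (c s)) t)) by ring.
    apply (is_derive_plus (V := R_NormedModule)). apply (is_derive_const (V := R_NormedModule)).
    apply (is_derive_plus (V := R_NormedModule)); apply is_derive_scal; auto.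
  - replace (sim_g M * Derive (fun s => fst (c s)) t + sim_e M * sim_a M * Derive (fun s => snd (c s)) t)
      with (0 + (sim_g M * Derive (fun s => fst (c s)) t + sim_e M * sim_a M * Derive (fun s => snd (c s)) t)) by ring.
    apply (is_derive_plus (V := R_NormedModule)). apply (is_derive_const (V := R_NormedModule)).
    apply (is_derive_plus (V := R_NormedModule)); apply is_derive_scal; auto.
Qed.

Lemma velocity_app_eq (c : R -> point) t :
  ex_derive (fun s => fst (c s)) t /\ ex_derive (fun s => snd (c s)) t ->
  velocity (fun s => sim_app M (c s)) t = sim_lin M (velocity c t).
Proof.
  intros H. destruct (velocity_app c t H) as [H1 H2]. apply is_derive_unique in H1, H2.
  rewrite (surjective_pairing (sim_lin M (velocity c t))). exact (f_equal2 pair H1 H2).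
Qed.

Lemma parametrizes_app c T (G G' : point -> Prop) : related G G' ->
  parametrizes c T G -> parametrizes (fun t => sim_app M (c t)) T G'.
Proof.
  intros HG [H1 H2 H3 H4 H5 H6 H7]. split.
  - exact H1.
  - intros t. destruct (velocity_app c t (H2 t)). split; eexists; eassumption.
  - intros t. apply continuous_ext with (f := fun t => sim_lin M (velocity c t)).
    intros x. symmetry. apply velocity_app_eq, H2. apply continuous_sim_lin, H3.
  - intros t. rewrite velocity_app_eq by apply H2. apply sim_lin_neq_0, H4.
  - intros t. now rewrite H5.
  - intros s t H. apply H6. now apply sim_app_inj.
  - intros P. destruct (sim_inverse M) as (N & MN & _).
    rewrite <- (MN P). rewrite (HG (sim_app N P)). rewrite H7. split; intros [t Ht]; exists t.
    + now rewrite Ht.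
    + apply sim_app_inj. exact Ht.
Qed.

Lemma tangent_vector_app (G G' : point -> Prop) P v : related G G' ->
  tangent_vector G P v -> tangent_vector G' (sim_app M P) (sim_lin M v).
Proof.
  intros HG (c & T & t & H & H1 & H2). exists (fun t => sim_app M (c t)), T, t.
  split; [|split]. now apply (parametrizes_app c T G). now rewrite H1.
  rewrite velocity_app_eq by apply (param_derivable _ _ _ H). now rewrite H2.
Qed.

Lemma tangent_link_app (G G' : point -> Prop) A B : related G G' ->
  tangent_link G A B -> tangent_link G' (sim_app M A) (sim_app M B).
Proof.
  intros HG (P & v & H1 & (s & Hs & HP) & H3). exists (sim_app M P), (sim_lin M v). repeat split.
  - now apply (tangent_vector_app G).
  - exists s. split; auto. subst P. unfold sim_app, sim_lin. simpl. f_equal; ring.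
  - rewrite vec_sim_app, cross_sim_lin, H3. ring.
Qed.

Lemma reflects_app A P B v :
  reflects A P B v -> reflects (sim_app M A) (sim_app M P) (sim_app M B) (sim_lin M v).
Proof.
  intros [H1 H2]. assert (K := sim_pos M). unfold reflects.
  rewrite !edist_sim_app, !vec_sim_app, !dot_sim_lin, !cross_sim_lin. unfold Rdiv in *. rewrite !Rinv_mult.
  set (k := sim_k M) in *. assert (Hk : k * / k = 1) by (field; lra).
  set (i := / k) in *. clearbody i k.
  split.
  - transitivity (k * (k * i) * (dot (vec A P) v * / edist A P)). ring. rewrite H1. ring.
  - transitivity (sim_e M * k * (k * i) * (cross (vec A P) v * / edist A P)). ring. rewrite H2. ring.
Qed.

Lemma orbit_length_app x q : orbit_length (fun i => sim_app M (x i)) q = sim_k M * orbit_length x q.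
Proof.
  unfold orbit_length. rewrite (sum_n_ext _ (fun i => sim_k M * edist (x (Z.of_nat i)) (x (Z.of_nat i + 1)%Z))).
  - apply (sum_n_mult_l (K := R_Ring)).
  - intros i. apply edist_sim_app.
Qed.

Lemma arclength_app c T (G : point -> Prop) a b : parametrizes c T G ->
  arclength (fun t => sim_app M (c t)) a b = sim_k M * arclength c a b.
Proof.
  intros H. unfold arclength.
  assert (K := sim_pos M).
  rewrite (RInt_ext _ (fun t => scal (sim_k M) (speed c t))).
  - apply (RInt_scal (V := R_CompleteNormedModule)). apply (ex_RInt_continuous (V := R_CompleteNormedModule)).
    intros z _. unfold speed. apply (continuous_comp _ sqrt); [|apply continuous_sqrt].
    assert (C := param_C1 _ _ _ H z).
    assert (H1 : continuous (fun s => fst (velocity c s)) z).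
    { apply (continuous_comp (velocity c) fst); auto. apply continuous_fst. }
    assert (H2 : continuous (fun s => snd (velocity c s)) z).
    { apply (continuous_comp (velocity c) snd); auto. apply continuous_snd. }
    apply (continuous_plus (V := R_NormedModule)); apply (continuous_mult (K := R_AbsRing)); auto.
  - intros t _. unfold speed. rewrite velocity_app_eq by apply (param_derivable _ _ _ H).
    rewrite dot_sim_lin, sqrt_mult, sqrt_square; try nra. reflexivity.
    unfold dot. nra.
Qed.
End Transport.

Lemma related_inverse M N G G' : (forall P, sim_app M (sim_app N P) = P) ->
  related M G G' -> related N G' G.
Proof. intros MN HG P. rewrite <- (HG (sim_app N P)), MN. reflexivity. Qed.

Lemma related_boundary M G G' : related M G G' -> related M (boundary G) (boundary G').
Proof.
  intros HG P. destruct (sim_inverse M) as (N & MN & NM). split; intros H.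
  - rewrite <- (NM P). apply (boundary_app N G'); auto. now apply (related_inverse M N).
  - now apply (boundary_app M G).
Qed.

Lemma tangent_orbit_app M O O' G G' x : related M O O' -> related M G G' ->
  tangent_orbit O G x -> tangent_orbit O' G' (fun k => sim_app M (x k)).
Proof.
  intros HO HG [[H1 [H2 H3]] [k Hk]]. split; [split; [|split]|].
  - intros i. now apply (boundary_app M O).
  - intros i H. now apply (H2 i), (sim_app_inj M).
  - intros i. destruct (H3 i) as (v & Hv & Hr). exists (sim_lin M v). split.
    + apply (tangent_vector_app M (boundary O)); auto. now apply related_boundary.
    + now apply reflects_app.
  - exists k. now apply (tangent_link_app M G).
Qed.

Lemma has_period_app M x q : has_period (fun k => sim_app M (x k)) q <-> has_period x q.
Proof.
  split; intros [Hq H]; split; auto; intros k.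
  - apply (sim_app_inj M), H.
  - now rewrite H.
Qed.

Lemma orbit_type_app M O O' x p q : related M O O' ->
  orbit_type O x p q -> orbit_type O' (fun k => sim_app M (x k)) p q.
Proof.
  intros HO ([Hq Hm] & Hpq & c & T & t & Hc & H1 & H2 & H3).
  split; [split|split]; auto.
  - now apply has_period_app.
  - intros r Hr. apply Hm. exact (proj1 (has_period_app M x r) Hr).
  - exists (fun s => sim_app M (c s)), T, t. split; [|split; [|split]]; auto.
    + apply (parametrizes_app M c T (boundary O)); auto. now apply related_boundary.
    + intros k. now rewrite H1.
    + intros k. rewrite !(arclength_app M c T (boundary O)) by auto. rewrite H3. ring.
Qed.

(** Properties of a caustic quantify over all orbits of the image domain, so such an orbit must
    first be written as the image of an orbit of the original one. *)
Lemma tangent_orbit_pull M N O O' G G' x : (forall P, sim_app M (sim_app N P) = P) ->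
  related M O O' -> related M G G' -> tangent_orbit O' G' x ->
  exists y, tangent_orbit O G y /\ x = (fun k => sim_app M (y k)).
Proof.
  intros MN HO HG H. exists (fun k => sim_app N (x k)). split.
  - apply (tangent_orbit_app N O' O G' G); auto; now apply (related_inverse M N).
  - apply functional_extensionality. intros k. symmetry. apply MN.
Qed.

Lemma caustic_type_app M O O' G G' p q : related M O O' -> related M G G' ->
  rational_caustic_of_type O G p q -> rational_caustic_of_type O' G' p q.
Proof.
  intros HO HG [[[[c [T H1]] [H2 H3]] H4] H5]. destruct (sim_inverse M) as (N & MN & NM).
  split; [split; [split; [|split]|]|].
  - exists (fun t => sim_app M (c t)), T. now apply (parametrizes_app M c T G).
  - intros P HP. rewrite <- (MN P). apply HO, H2. apply (related_inverse M N G G' MN HG). exact HP.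
  - intros x Hx k. destruct (tangent_orbit_pull M N O O' G G' x) as (y & Hy & ->); auto.
    apply (tangent_link_app M G); auto.
  - intros x Hx. destruct (tangent_orbit_pull M N O O' G G' x) as (y & Hy & ->); auto.
    destruct (H4 y Hy) as [r Hr]. exists r. now apply has_period_app.
  - intros x Hx. destruct (tangent_orbit_pull M N O O' G G' x) as (y & Hy & ->); auto.
    apply (orbit_type_app M O); auto.
Qed.

Lemma equal_length_app M O O' p q p' q' : related M O O' ->
  equal_length_caustics O p q p' q' -> equal_length_caustics O' p q p' q'.
Proof.
  intros HO (G & G' & HN & H1 & H2 & H3 & L & H4 & H5).
  destruct (sim_inverse M) as (N & MN & NM).
  assert (R : forall K, related M K (fun P => K (sim_app N P))) by (intros K P; rewrite NM; reflexivity).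
  exists (fun P => G (sim_app N P)), (fun P => G' (sim_app N P)).
  split; [|split; [|split; [|split; [|exists (sim_k M * L); split]]]].
  - intros E. apply HN. apply functional_extensionality. intros P.
    rewrite <- (NM P). exact (f_equal (fun f => f (sim_app M P)) E).
  - now apply (caustic_type_app M O O' G).
  - now apply (caustic_type_app M O O' G').
  - exact H3.
  - intros x Hx. destruct (tangent_orbit_pull M N O O' G (fun P => G (sim_app N P)) x) as (y & Hy & ->); auto.
    rewrite orbit_length_app, H4; auto.
  - intros x Hx. destruct (tangent_orbit_pull M N O O' G' (fun P => G' (sim_app N P)) x) as (y & Hy & ->); auto.
    rewrite orbit_length_app, H5; auto.
Qed.

(** * Ellipses in standard position *)

Definition qform (A B : R) (P : point) : R := fst P * fst P / (A * A) + snd P * snd P / (B * B).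
Definition ellipse_pt (A B t : R) : point := (A * cos t, B * sin t).

Lemma trig_period_Z x k : cos (x + IZR k * (2 * PI)) = cos x /\ sin (x + IZR k * (2 * PI)) = sin x.
Proof.
  destruct (Z_le_gt_dec 0 k) as [H|H].
  - rewrite <- (Z2Nat.id k H), <- INR_IZR_INZ.
    replace (x + INR (Z.to_nat k) * (2 * PI)) with (x + 2 * INR (Z.to_nat k) * PI) by ring.
    now rewrite cos_period, sin_period.
  - set (y := x + IZR k * (2 * PI)).
    replace x with (y + 2 * INR (Z.to_nat (- k)) * PI).
    now rewrite cos_period, sin_period.
    unfold y. rewrite INR_IZR_INZ, Z2Nat.id, opp_IZR by lia. ring.
Qed.

Lemma trig_eq_period x y : cos x = cos y -> sin x = sin y -> exists k : Z, x = y + IZR k * (2 * PI).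
Proof.
  intros Hc Hs.
  assert (C : cos (x - y) = 1).
  { rewrite cos_minus, Hc, Hs. generalize (sin2_cos2 y). unfold Rsqr. lra. }
  assert (S : sin (x - y) = 0) by (rewrite sin_minus, Hc, Hs; ring).
  destruct (sin_eq_0_0 _ S) as [k Hk].
  destruct (Z.Even_or_Odd k) as [[j ->]|[j ->]].
  - exists j. rewrite mult_IZR in Hk. lra.
  - exfalso. rewrite Hk, plus_IZR, mult_IZR in C.
    replace ((2 * IZR j + 1) * PI) with (PI + IZR j * (2 * PI)) in C by ring.
    rewrite (proj1 (trig_period_Z _ _)), cos_PI in C. lra.
Qed.

Lemma unit_circle u v : u * u + v * v = 1 -> exists t, cos t = u /\ sin t = v.
Proof.
  intros H. assert (Hu : -1 <= u <= 1) by nra.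
  assert (S : sin (acos u) = sqrt (v * v)).
  { rewrite sin_acos by auto. f_equal. unfold Rsqr. lra. }
  destruct (Rle_lt_dec 0 v).
  - exists (acos u). rewrite cos_acos, S, sqrt_square by auto. auto.
  - exists (- acos u). rewrite cos_neg, sin_neg, cos_acos, S by auto. split; auto.
    replace (v * v) with (- v * - v) by ring. rewrite sqrt_square by lra. ring.
Qed.

Lemma qform_ellipse_pt A B t : 0 < A -> 0 < B -> qform A B (ellipse_pt A B t) = 1.
Proof.
  intros HA HB. unfold qform, ellipse_pt. simpl. generalize (sin2_cos2 t). unfold Rsqr. intros H.
  rewrite <- H. field. lra.
Qed.

Lemma qform_param A B P : 0 < A -> 0 < B -> qform A B P = 1 -> exists t, ellipse_pt A B t = P.
Proof.
  intros HA HB H. destruct P as [x y]. unfold qform in H. simpl in H.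
  destruct (unit_circle (x / A) (y / B)) as [t [H1 H2]].
  - rewrite <- H. field. lra.
  - exists t. unfold ellipse_pt. rewrite H1, H2. apply f_equal2; field; lra.
Qed.

Lemma velocity_ellipse_pt A B t : velocity (ellipse_pt A B) t = (- A * sin t, B * cos t).
Proof.
  unfold velocity, ellipse_pt. simpl. apply f_equal2; apply is_derive_unique; auto_derive; auto; ring.
Qed.

Lemma parametrizes_ellipse_pt A B : 0 < A -> 0 < B ->
  parametrizes (ellipse_pt A B) (2 * PI) (fun P => qform A B P = 1).
Proof.
  intros HA HB. split.
  - generalize PI_RGT_0. lra.
  - intros t. unfold ellipse_pt. simpl. split; auto_derive; auto.
  - intros t. apply continuous_ext with (f := fun t => (- A * sin t, B * cos t)).
    intros x. symmetry. apply velocity_ellipse_pt.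
    apply (continuous_comp_2 (fun t => - A * sin t) (fun t => B * cos t) (fun x y => (x, y))).
    + apply (ex_derive_continuous (V := R_NormedModule)). auto_derive. auto.
    + apply (ex_derive_continuous (V := R_NormedModule)). auto_derive. auto.
    + apply continuous_ext with (f := fun x => x). intros []; reflexivity. apply continuous_id.
  - intros t H. rewrite velocity_ellipse_pt in H. injection H. intros H1 H2.
    assert (cos t = 0) by (apply Rmult_integral in H1; destruct H1; auto; lra).
    assert (sin t = 0) by (apply Rmult_integral in H2; destruct H2; auto; lra).
    generalize (sin2_cos2 t). unfold Rsqr. rewrite H0, H3. lra.
  - intros t. unfold ellipse_pt. rewrite <- (Rmult_1_l (2 * PI)).
    destruct (trig_period_Z t 1) as [-> ->]. reflexivity.
  - intros x t H. injection H. intros H1 H2.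
    apply trig_eq_period; [apply (Rmult_eq_reg_l A)|apply (Rmult_eq_reg_l B)]; lra.
  - intros P. split.
    + apply qform_param; auto.
    + intros [t <-]. now apply qform_ellipse_pt.
Qed.

Lemma tangent_vector_ellipse_pt A B t : 0 < A -> 0 < B ->
  tangent_vector (fun P => qform A B P = 1) (ellipse_pt A B t) (- A * sin t, B * cos t).
Proof.
  intros HA HB. exists (ellipse_pt A B), (2 * PI), t.
  split; [now apply parametrizes_ellipse_pt|]. split; [reflexivity|apply velocity_ellipse_pt].
Qed.

(** The vector comes from an arbitrary regular parametrization. Differentiating [qform = 1] along it
    shows that the velocity is orthogonal to the gradient, hence a multiple of the standard one,
    nonzero by regularity. *)
Lemma tangent_vector_inv A B t v : 0 < A -> 0 < B ->
  tangent_vector (fun P => qform A B P = 1) (ellipse_pt A B t) v ->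
  exists k, k <> 0 /\ v = (k * (- A * sin t), k * (B * cos t)).
Proof.
  intros HA HB (c & T & x & Hc & H1 & H2).
  destruct (param_derivable _ _ _ Hc x) as [D1 D2].
  apply Derive_correct in D1, D2.
  assert (D : is_derive (fun y => qform A B (c y)) x
    (2 * fst (c x) * fst v / (A * A) + 2 * snd (c x) * snd v / (B * B))).
  { rewrite <- H2. unfold velocity. simpl. unfold qform.
    set (f := fun s => fst (c s)) in *. set (g := fun s => snd (c s)) in *.
    change (fst (c x)) with (f x). change (snd (c x)) with (g x).
    apply (is_derive_ext (fun y => f y * f y / (A * A) + g y * g y / (B * B))). reflexivity.
    assert (E1 : ex_derive f x) by (eexists; eassumption).
    assert (E2 : ex_derive g x) by (eexists; eassumption).
    auto_derive. auto.
    change (Derive (fun x0 => f x0) x) with (Derive f x).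
    change (Derive (fun x0 => g x0) x) with (Derive g x). field. lra. }
  assert (Z : 2 * fst (c x) * fst v / (A * A) + 2 * snd (c x) * snd v / (B * B) = 0).
  { apply is_derive_unique in D. rewrite <- D.
    rewrite (Derive_ext _ (fun _ => 1)). apply Derive_const.
    intros y. apply (param_image _ _ _ Hc). now exists y. }
  rewrite H1 in Z. unfold ellipse_pt in Z. simpl in Z.
  assert (Z' : fst v * cos t / A + snd v * sin t / B = 0).
  { replace (fst v * cos t / A + snd v * sin t / B)
      with (/ 2 * (2 * (A * cos t) * fst v / (A * A) + 2 * (B * sin t) * snd v / (B * B))).
    rewrite Z. ring. field. lra. }
  set (p := fst v / A) in *. set (q := snd v / B) in *.
  assert (Ep : fst v = A * p) by (unfold p; field; lra).
  assert (Eq : snd v = B * q) by (unfold q; field; lra).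
  assert (Z2 : p * cos t + q * sin t = 0) by (rewrite <- Z'; unfold p, q; field; lra).
  exists (q * cos t - p * sin t).
  assert (S := sin2_cos2 t). unfold Rsqr in S.
  assert (Ev : v = ((q * cos t - p * sin t) * (- A * sin t), (q * cos t - p * sin t) * (B * cos t))).
  { rewrite (surjective_pairing v), Ep, Eq. apply f_equal2.
    - transitivity (A * (p * (sin t * sin t + cos t * cos t) - cos t * (p * cos t + q * sin t))).
      rewrite S, Z2. ring. ring.
    - transitivity (B * (q * (sin t * sin t + cos t * cos t) - sin t * (p * cos t + q * sin t))).
      rewrite S, Z2. ring. ring. }
  split; auto. intros K. rewrite K, !Rmult_0_l in Ev.
  apply (param_regular _ _ _ Hc x). now rewrite H2.
Qed.

(** * The focal description and the boundary *)

(** With [q] the value of [qform], the squared focal distances are [(1 + c x)^2] and [(1 - c x)^2],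
    each increased by [b^2 (q - 1)]. So the distances lie below [1 + c x] and [1 - c x], whose sum
    is 2, exactly when [q < 1]. *)
Lemma focal_ellipse b c P : 0 < b <= 1 -> 0 <= c -> c * c = 1 - b * b ->
  (edist P (- c, 0) + edist P (c, 0) < 2 <-> qform 1 b P < 1).
Proof.
  intros Hb Hc E. destruct P as [x y]. unfold edist, dist_euc, qform, Rsqr. simpl.
  rewrite Rminus_0_r.
  replace (x - - c) with (x + c) by ring.
  assert (c < 1) by nra.
  assert (W : (x + c) * (x + c) + y * y = (1 + c * x) * (1 + c * x) + b * b * (x * x / (1 * 1) + y * y / (b * b) - 1)).
  { replace (b * b * (x * x / (1 * 1) + y * y / (b * b) - 1)) with ((b * b) * x * x + y * y - b * b) by (field; lra).
    replace (b * b) with (1 - c * c) by lra. ring. }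
  assert (W' : (x - c) * (x - c) + y * y = (1 - c * x) * (1 - c * x) + b * b * (x * x / (1 * 1) + y * y / (b * b) - 1)).
  { replace (b * b * (x * x / (1 * 1) + y * y / (b * b) - 1)) with ((b * b) * x * x + y * y - b * b) by (field; lra).
    replace (b * b) with (1 - c * c) by lra. ring. }
  rewrite W, W'. set (q := x * x / (1 * 1) + y * y / (b * b)) in *.
  assert (Hq : x * x <= q).
  { unfold q. assert (0 <= y * y / (b * b)). apply Rmult_le_pos. nra. apply Rlt_le, Rinv_0_lt_compat. nra.
    replace (x * x / (1 * 1)) with (x * x) by field. lra. }
  assert (Hbb : 0 < b * b) by nra.
  split; intros H0.
  - apply Rnot_le_lt. intros F.
    assert (0 <= b * b * (q - 1)) by nra.
    assert (A1 : forall z, z <= sqrt (z * z + b * b * (q - 1))).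
    { intros z. apply Rle_trans with (Rabs z). apply Rle_abs. rewrite <- sqrt_Rsqr_abs.
      apply sqrt_le_1_alt. unfold Rsqr. lra. }
    generalize (A1 (1 + c * x)) (A1 (1 - c * x)). lra.
  - assert (b * b * (q - 1) < 0) by nra.
    assert (-1 < x < 1) by (split; nra).
    assert (A1 : forall z, 0 < z -> 0 <= z * z + b * b * (q - 1) -> sqrt (z * z + b * b * (q - 1)) < z).
    { intros z Hz Hz'. apply Rlt_le_trans with (sqrt (z * z)).
      apply sqrt_lt_1; nra. rewrite sqrt_square; lra. }
    assert (0 <= c * (1 + x)) by (apply Rmult_le_pos; lra).
    assert (0 <= c * (1 - x)) by (apply Rmult_le_pos; lra).
    assert (B1 : sqrt ((1 + c * x) * (1 + c * x) + b * b * (q - 1)) < 1 + c * x).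
    { apply A1. lra. rewrite <- W. generalize (Rle_0_sqr (x + c)) (Rle_0_sqr y). unfold Rsqr. lra. }
    assert (B2 : sqrt ((1 - c * x) * (1 - c * x) + b * b * (q - 1)) < 1 - c * x).
    { apply A1. lra. rewrite <- W'. generalize (Rle_0_sqr (x - c)) (Rle_0_sqr y). unfold Rsqr. lra. }
    lra.
Qed.

Definition disk (b : R) (P : point) : Prop := qform 1 b P < 1.

Lemma qform_continuous A B P : continuous (qform A B) P.
Proof.
  assert (H1 : continuous (fst : point -> R) P) by apply continuous_fst.
  assert (H2 : continuous (snd : point -> R) P) by apply continuous_snd.
  apply (continuous_plus (V := R_NormedModule)); unfold Rdiv;
    apply (continuous_mult (K := R_AbsRing));
    try apply continuous_const; apply (continuous_mult (K := R_AbsRing)); auto.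
Qed.

Lemma boundary_disk b P : 0 < b -> (boundary (disk b) P <-> qform 1 b P = 1).
Proof.
  intros Hb. unfold boundary. split.
  - intros [H1 H2]. destruct (Rtotal_order (qform 1 b P) 1) as [H|[H|H]]; auto; exfalso.
    + apply H1. apply (qform_continuous 1 b P (fun x => x < 1)).
      apply (open_lt 1). exact H.
    + apply H2. generalize (qform_continuous 1 b P (fun x => 1 < x) (open_gt 1 _ H)).
      unfold filtermap. apply filter_imp. intros Q HQ HQ'. unfold disk in HQ'. lra.
  - intros H. split; intros L.
    + apply locally_singleton in L. unfold disk in L. lra.
    (* Points of the disk near [P] are found by shrinking [P] radially, which multiplies [qform] by
       [r * r]. *)
    + assert (C : continuous (fun r => (r * fst P, r * snd P)) 1).
      { apply (continuous_comp_2 (fun r => r * fst P) (fun r => r * snd P) (fun x y => (x, y))).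
        - apply (ex_derive_continuous (V := R_NormedModule)). auto_derive. auto.
        - apply (ex_derive_continuous (V := R_NormedModule)). auto_derive. auto.
        - apply continuous_ext with (f := fun x => x). intros []; reflexivity. apply continuous_id. }
      assert (L' : locally (1 : R) (fun r => ~ disk b (r * fst P, r * snd P))).
      { apply (C (fun Q => ~ disk b Q)). now rewrite !Rmult_1_l, <- surjective_pairing. }
      destruct L' as [d Hd].
      set (r := 1 - Rmin (d / 2) (1 / 2)).
      assert (M1 := Rmin_l (d / 2) (1 / 2)). assert (M2 := Rmin_r (d / 2) (1 / 2)).
      assert (Hd0 := cond_pos d).
      assert (M3 : 0 < Rmin (d / 2) (1 / 2)) by (apply Rmin_pos; lra).
      apply (Hd r).
      * change (Rabs (r - 1) < d). unfold r. rewrite Rabs_left1; lra.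
      * unfold disk. replace (qform 1 b (r * fst P, r * snd P)) with (r * r * qform 1 b P).
        rewrite H. unfold r. nra. unfold qform. simpl. field. lra.
Qed.

(** * Links and reflections in standard position *)

Lemma edist_pos P Q : P <> Q -> 0 < edist P Q.
Proof.
  intros H. rewrite edist_dot. apply sqrt_lt_R0. unfold dot, vec. simpl.
  destruct P as [x y], Q as [x' y']. simpl.
  destruct (Req_dec x x') as [->|N].
  - assert (Ny : y <> y') by congruence.
    assert (0 < (y' - y) * (y' - y)) by (apply Rsqr_pos_lt; intros Z; apply Ny; lra). nra.
  - assert (0 < (x' - x) * (x' - x)) by (apply Rsqr_pos_lt; intros Z; apply N; lra).
    generalize (Rle_0_sqr (y' - y)). unfold Rsqr. lra.
Qed.

Lemma edist_sym P Q : edist P Q = edist Q P.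
Proof. unfold edist. apply distance_symm. Qed.

Lemma reflects_reverse A P B v : reflects A P B v -> reflects B P A v.
Proof.
  intros [H1 H2]. unfold reflects. rewrite (edist_sym B P), (edist_sym P A).
  replace (dot (vec B P) v) with (- dot (vec P B) v) by (unfold dot, vec; simpl; ring).
  replace (dot (vec P A) v) with (- dot (vec A P) v) by (unfold dot, vec; simpl; ring).
  replace (cross (vec B P) v) with (- cross (vec P B) v) by (unfold cross, vec; simpl; ring).
  replace (cross (vec P A) v) with (- cross (vec A P) v) by (unfold cross, vec; simpl; ring).
  unfold Rdiv in *. split; lra.
Qed.

Lemma reflects_scale A P B v1 v2 k : reflects A P B (v1, v2) -> reflects A P B (k * v1, k * v2).
Proof.
  intros [H1 H2]. unfold reflects.
  replace (dot (vec A P) (k * v1, k * v2)) with (k * dot (vec A P) (v1, v2)) by (unfold dot, vec; simpl; ring).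
  replace (dot (vec P B) (k * v1, k * v2)) with (k * dot (vec P B) (v1, v2)) by (unfold dot, vec; simpl; ring).
  replace (cross (vec A P) (k * v1, k * v2)) with (k * cross (vec A P) (v1, v2)) by (unfold cross, vec; simpl; ring).
  replace (cross (vec P B) (k * v1, k * v2)) with (k * cross (vec P B) (v1, v2)) by (unfold cross, vec; simpl; ring).
  unfold Rdiv in *. rewrite !Rmult_assoc, H1, H2. split; ring.
Qed.

(** The reflection law fixes the outgoing unit direction, so [B - P] is [r] times [B' - P] with
    [r > 0]. A line through a point of the ellipse meets it at most once more, which forces
    [r = 1]. *)
Lemma reflects_unique b A P B B' v : 0 < b ->
  qform 1 b P = 1 -> qform 1 b B = 1 -> qform 1 b B' = 1 -> P <> B -> P <> B' -> v <> (0, 0) ->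
  reflects A P B v -> reflects A P B' v -> B = B'.
Proof.
  intros Hb HP HB HB' N N' Hv [H1 H2] [H3 H4].
  assert (D := edist_pos P B N). assert (D' := edist_pos P B' N').
  rewrite H1 in H3. rewrite H2 in H4. clear H1 H2.
  set (e := edist P B) in *. set (e' := edist P B') in *. clearbody e e'.
  destruct P as [x y], B as [p q], B' as [p' q'], v as [v1 v2].
  unfold dot, cross, vec in *. simpl in *.
  set (r := e / e'). assert (Hr : 0 < r) by (apply Rdiv_lt_0_compat; auto).
  assert (K1 : (p - x) * v1 + (q - y) * v2 = r * ((p' - x) * v1 + (q' - y) * v2)).
  { unfold r. apply (Rmult_eq_reg_r (/ e)). unfold Rdiv in H3. rewrite H3. field; lra.
    apply Rinv_neq_0_compat. lra. }
  assert (K2 : (p - x) * v2 - (q - y) * v1 = r * ((p' - x) * v2 - (q' - y) * v1)).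
  { unfold r. apply (Rmult_eq_reg_r (/ e)). unfold Rdiv in H4.
    transitivity ((p' - x) * v2 * / e' - (q' - y) * v1 * / e'). lra. field; lra.
    apply Rinv_neq_0_compat. lra. }
  assert (V : v1 * v1 + v2 * v2 <> 0).
  { intros Z. apply Hv. apply f_equal2; nra. }
  assert (K3 : p - x = r * (p' - x)).
  { apply (Rmult_eq_reg_r (v1 * v1 + v2 * v2)); auto.
    transitivity (v1 * ((p - x) * v1 + (q - y) * v2) + v2 * ((p - x) * v2 - (q - y) * v1)). ring.
    rewrite K1, K2. ring. }
  assert (K4 : q - y = r * (q' - y)).
  { apply (Rmult_eq_reg_r (v1 * v1 + v2 * v2)); auto.
    transitivity (v2 * ((p - x) * v1 + (q - y) * v2) - v1 * ((p - x) * v2 - (q - y) * v1)). ring.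
    rewrite K1, K2. ring. }
  assert (HbB : 0 < b * b) by nra.
  assert (G : forall u w, qform 1 b (u, w) = 1 -> b * b * (u * u) + w * w = b * b).
  { intros u w E. unfold qform in E. simpl in E.
    transitivity (b * b * (u * u / (1 * 1) + w * w / (b * b))). field; lra. rewrite E. ring. }
  apply G in HP, HB, HB'. clear G.
  set (dx := p' - x) in *. set (dy := q' - y) in *.
  assert (P1 : p = x + r * dx) by lra. assert (Q1 : q = y + r * dy) by lra.
  assert (P2 : p' = x + dx) by (unfold dx; ring). assert (Q2 : q' = y + dy) by (unfold dy; ring).
  rewrite P1, Q1 in HB. rewrite P2, Q2 in HB'.
  assert (S : 0 < b * b * (dx * dx) + dy * dy).
  { destruct (Req_dec dx 0) as [Z1|Z1].
    - assert (dy <> 0). { intros Z2. apply N'. rewrite P2, Q2, Z1, Z2. apply f_equal2; ring. }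
      assert (0 < dy * dy) by (apply Rsqr_pos_lt; auto). rewrite Z1. lra.
    - assert (0 < dx * dx) by (apply Rsqr_pos_lt; auto). nra. }
  assert (F : r * (r - 1) * (b * b * (dx * dx) + dy * dy) = 0).
  { transitivity ((b * b * ((x + r * dx) * (x + r * dx)) + (y + r * dy) * (y + r * dy) - (b * b * (x * x) + y * y))
      - r * (b * b * ((x + dx) * (x + dx)) + (y + dy) * (y + dy) - (b * b * (x * x) + y * y))). ring.
    rewrite HP, HB, HB'. ring. }
  assert (r = 1).
  { apply Rmult_integral in F. destruct F as [F|F]; [|lra].
    apply Rmult_integral in F. destruct F; lra. }
  rewrite P1, P2, Q1, Q2, H. apply f_equal2; ring.
Qed.

Lemma boundary_disk_eq b : 0 < b -> boundary (disk b) = (fun P => qform 1 b P = 1).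
Proof.
  intros Hb. apply functional_extensionality. intros P.
  apply propositional_extensionality, boundary_disk, Hb.
Qed.

(** * The confocal caustic and its links *)

Section Caustic.
Variables b s : R.
Hypothesis Hs : 0 < s < b.
Hypothesis Hb : b < 1.

Local Notation dl := (half_angle b s).
Local Notation pt := (ellipse_pt 1 b).
Local Notation ca := (sqrt (1 - s * s)).
Local Notation cb := (sqrt (b * b - s * s)).

Definition confocal (P : point) : Prop := qform ca cb P = 1.

Lemma ca_sq : ca * ca = 1 - s * s.
Proof. apply sqrt_sqrt. nra. Qed.
Lemma cb_sq : cb * cb = b * b - s * s.
Proof. apply sqrt_sqrt. nra. Qed.
Lemma ca_pos : 0 < ca.
Proof. apply sqrt_lt_R0. nra. Qed.
Lemma cb_pos : 0 < cb.
Proof. apply sqrt_lt_R0. nra. Qed.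

Lemma confocal_inside P : confocal P -> disk b P.
Proof.
  unfold confocal, disk, qform. intros H. rewrite ca_sq, cb_sq in H.
  set (u := fst P * fst P / (1 - s * s)) in *. set (w := snd P * snd P / (b * b - s * s)) in *.
  assert (Hu : 0 <= u). { apply Rmult_le_pos. nra. apply Rlt_le, Rinv_0_lt_compat. nra. }
  assert (Hw : 0 <= w). { apply Rmult_le_pos. nra. apply Rlt_le, Rinv_0_lt_compat. nra. }
  replace (fst P * fst P / (1 * 1)) with ((1 - s * s) * u) by (unfold u; field; nra).
  replace (snd P * snd P / (b * b)) with ((1 - s * s / (b * b)) * w) by (unfold w; field; split; nra).
  assert (Hr : 0 < s * s / (b * b)) by (apply Rdiv_lt_0_compat; nra).
  set (r := s * s / (b * b)) in *. clearbody u w r.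
  assert (0 < s * s) by nra.
  assert (0 <= s * s * u) by (apply Rmult_le_pos; lra).
  assert (0 <= r * w) by (apply Rmult_le_pos; lra).
  destruct Hu as [Hu|Hu].
  - assert (0 < s * s * u) by (apply Rmult_lt_0_compat; lra). lra.
  - subst u. assert (w = 1) by lra. subst w. lra.
Qed.

Lemma vec_link m : vec (pt (m - dl m)) (pt (m + dl m)) =
  (- 2 * sin m * sin (dl m), 2 * b * cos m * sin (dl m)).
Proof.
  unfold vec, ellipse_pt. simpl. rewrite cos_minus, cos_plus, sin_minus, sin_plus. apply f_equal2; ring.
Qed.

Lemma edist_link m : edist (pt (m - dl m)) (pt (m + dl m)) = 2 * s / b * speed_sq b m.
Proof.
  rewrite edist_dot, vec_link. unfold dot. simpl.
  replace (- 2 * sin m * sin (dl m) * (- 2 * sin m * sin (dl m)) +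
    2 * b * cos m * sin (dl m) * (2 * b * cos m * sin (dl m)))
    with (4 * (sin (dl m) * sin (dl m)) * speed_sq b m) by (unfold speed_sq; ring).
  rewrite sin_half_angle_sq by auto.
  replace (4 * (s * s / (b * b) * speed_sq b m) * speed_sq b m)
    with ((2 * s / b * speed_sq b m) * (2 * s / b * speed_sq b m)) by (field; lra).
  apply sqrt_square. apply Rlt_le, Rmult_lt_0_compat. apply Rdiv_lt_0_compat; lra.
  now apply (speed_sq_pos b s).
Qed.

(** The cross product of the unit link direction with the boundary velocity has absolute value [s]
    at every bounce (Joachimsthal's integral), and the dot product is the value of [radical] at the
    bounce. Both depend on the boundary point alone, so consecutive links obey the reflection
    law. *)
Lemma link_directions m :
  let v x := (- 1 * sin x, b * cos x) in
  let w := vec (pt (m - dl m)) (pt (m + dl m)) in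
  let e := edist (pt (m - dl m)) (pt (m + dl m)) in
  dot w (v (m - dl m)) / e = radical b s (m - dl m) /\
  dot w (v (m + dl m)) / e = radical b s (m + dl m) /\
  cross w (v (m - dl m)) / e = - s /\ cross w (v (m + dl m)) / e = s.
Proof.
  cbv zeta. rewrite edist_link, vec_link, radical_start, radical_end by auto.
  unfold dot, cross. cbn [fst snd].
  rewrite cos_minus, cos_plus, sin_minus, sin_plus.
  assert (D := speed_sq_pos b s Hs Hb m). assert (R := sqrt_lt_R0 _ D).
  assert (RR : sqrt (speed_sq b m) * sqrt (speed_sq b m) = speed_sq b m) by (apply sqrt_sqrt; lra).
  assert (S := sin_half_angle b s Hs Hb m). unfold radical_mean, radical_skew.
  assert (SS := sin_half_angle_sq b s Hs Hb m).
  set (r := sqrt (speed_sq b m)) in *. set (S0 := sin (dl m)) in *. set (C := cos (dl m)) in *.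
  assert (E : speed_sq b m = sin m * sin m + b * b * (cos m * cos m)) by reflexivity.
  assert (T := sin2_cos2 m). unfold Rsqr in T.
  split; [|split; [|split]].
  - transitivity (2 * S0 * (C * speed_sq b m - S0 * (1 - b * b) * (sin m * cos m)) / (2 * s / b * speed_sq b m)).
    f_equal. rewrite E. ring. rewrite <- RR, S. field. repeat split; lra.
  - transitivity (2 * S0 * (C * speed_sq b m + S0 * (1 - b * b) * (sin m * cos m)) / (2 * s / b * speed_sq b m)).
    f_equal. rewrite E. ring. rewrite <- RR, S. field. repeat split; lra.
  - transitivity (- 2 * b * (S0 * S0) * (sin m * sin m + cos m * cos m) / (2 * s / b * speed_sq b m)).
    f_equal. ring. rewrite T, SS. field. repeat split; lra.
  - transitivity (2 * b * (S0 * S0) * (sin m * sin m + cos m * cos m) / (2 * s / b * speed_sq b m)).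
    f_equal. ring. rewrite T, SS. field. repeat split; lra.
Qed.

Lemma reflects_link m m' : m + dl m = m' - dl m' ->
  reflects (pt (m - dl m)) (pt (m + dl m)) (pt (m' + dl m')) (- 1 * sin (m + dl m), b * cos (m + dl m)).
Proof.
  intros E. destruct (link_directions m) as (_ & H1 & _ & H2).
  destruct (link_directions m') as (H3 & _ & H4 & _).
  split.
  - rewrite H1, E. now rewrite H3.
  - rewrite H2, E, H4. ring.
Qed.

Lemma link_neq m : pt (m - dl m) <> pt (m + dl m).
Proof.
  intros H. assert (E := edist_link m). rewrite H in E.
  unfold edist in E. rewrite distance_refl in E.
  assert (0 < 2 * s / b * speed_sq b m); [|lra].
  apply Rmult_lt_0_compat. apply Rdiv_lt_0_compat; lra. now apply (speed_sq_pos b s).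
Qed.

Lemma cos_half_angle_sq m : cos (dl m) * cos (dl m) =
  (1 - s * s) * (cos m * cos m) + (b * b - s * s) / (b * b) * (sin m * sin m).
Proof.
  assert (SS := sin_half_angle_sq b s Hs Hb m).
  assert (T := sin2_cos2 m). assert (T' := sin2_cos2 (dl m)). unfold Rsqr in *.
  replace (cos (dl m) * cos (dl m)) with (1 - sin (dl m) * sin (dl m)) by lra.
  rewrite SS. transitivity ((sin m * sin m + cos m * cos m) - s * s / (b * b) * speed_sq b m).
  now rewrite T. unfold speed_sq. field. lra.
Qed.

Lemma link_tangent m : tangent_link confocal (pt (m - dl m)) (pt (m + dl m)).
Proof.
  assert (C := cos_half_angle_pos b s Hs Hb m). assert (CC := cos_half_angle_sq m).
  assert (A := ca_pos). assert (B := cb_pos). assert (AA := ca_sq). assert (BB := cb_sq).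
  (* The angle of contact comes from comparing the chord [x cos m + (y / b) sin m = cos (dl m)] with
     the tangent [x cos t / ca + y sin t / cb = 1] of the caustic. *)
  destruct (unit_circle (ca * cos m / cos (dl m)) (cb / b * sin m / cos (dl m))) as [t [Ht1 Ht2]].
  { transitivity ((ca * ca * (cos m * cos m) + cb * cb / (b * b) * (sin m * sin m)) / (cos (dl m) * cos (dl m))).
    field. lra. rewrite AA, BB, <- CC. field. lra. }
  exists (ellipse_pt ca cb t), (- ca * sin t, cb * cos t). split; [|split].
  - now apply tangent_vector_ellipse_pt.
  - assert (U := radical_mean_pos b s Hs Hb m). assert (N := radical_skew_bounds b s Hs Hb m).
    (* As [m] varies, the ends move across the chord at opposite velocities proportional to [1 - d']
       and [1 + d'], where [d'] is the derivative of [half_angle]. The envelope touches the chord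
       where this transverse velocity vanishes. *)
    exists ((1 - radical_skew b s m / radical_mean b s m) / 2). split.
    + assert (-1 < radical_skew b s m / radical_mean b s m < 1).
      { split; apply (Rmult_lt_reg_r (radical_mean b s m)); auto; field_simplify; lra. }
      lra.
    + assert (V := vec_link m). unfold vec in V. injection V. intros V2 V1. simpl in V1, V2.
      unfold ellipse_pt at 1. unfold ellipse_pt. cbn [fst snd]. rewrite V1, V2, Ht1, Ht2, cos_minus, sin_minus.
      assert (D := speed_sq_pos b s Hs Hb m). assert (R := sqrt_lt_R0 _ D).
      assert (S := sin_half_angle b s Hs Hb m). assert (SP := sin_half_angle_pos b s Hs Hb m).
      assert (Er : sqrt (speed_sq b m) = b / s * sin (dl m)) by (rewrite S; field; lra).
      assert (F : radical_skew b s m / radical_mean b s m * sin (dl m) = s * s * (1 - b * b) / (b * b) * (sin m * cos m) / cos (dl m)).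
      { unfold radical_skew, radical_mean. rewrite Er. field. repeat split; lra. }
      assert (T := sin2_cos2 m). unfold Rsqr in T.
      apply f_equal2.
      * transitivity (1 * (cos m * cos (dl m)) + sin m * (radical_skew b s m / radical_mean b s m * sin (dl m))); [|field; lra].
        rewrite F. apply (Rmult_eq_reg_r (cos (dl m))); [|lra].
        transitivity (ca * ca * cos m). field. lra.
        transitivity (cos m * (cos (dl m) * cos (dl m)) + s * s * (1 - b * b) / (b * b) * (sin m * sin m) * cos m); [|field; lra].
        rewrite AA, CC. replace (cos m * cos m) with (1 - sin m * sin m) by lra. field. lra.
      * transitivity (b * (sin m * cos (dl m)) - b * cos m * (radical_skew b s m / radical_mean b s m * sin (dl m))); [|field; lra].
        rewrite F. apply (Rmult_eq_reg_r (cos (dl m))); [|lra].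
        transitivity (cb * cb / b * sin m). field. lra.
        transitivity (b * sin m * (cos (dl m) * cos (dl m)) - s * s * (1 - b * b) / b * (cos m * cos m) * sin m); [|field; lra].
        rewrite BB, CC. replace (cos m * cos m) with (1 - sin m * sin m) by lra. field. lra.
  - rewrite vec_link. unfold cross. cbn [fst snd]. rewrite Ht1, Ht2. field. lra.
Qed.

Lemma half_angle_pi m : dl (m + PI) = dl m.
Proof. unfold half_angle. now rewrite speed_sq_pi. Qed.

Lemma half_angle_opp m : dl (- m) = dl m.
Proof. unfold half_angle. now rewrite speed_sq_opp. Qed.

(** For the chord with middle angle [m] and half-difference [d], contact and tangency say that
    [(X, Y)], rotated by [- t], is [(cos d, 0)]. Hence the square of [cos d] is that of
    [cos (dl m)]. A wrong sign of the sine reverses the link; a wrong sign of the cosine is absorbed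
    by replacing [m] with [m + PI]. *)
Lemma tangent_link_form P Q : qform 1 b P = 1 -> qform 1 b Q = 1 -> P <> Q ->
  tangent_link confocal P Q -> exists m,
    (P = pt (m - dl m) /\ Q = pt (m + dl m)) \/ (P = pt (m + dl m) /\ Q = pt (m - dl m)).
Proof.
  intros HP HQ N (R0 & v & Hv & (r & Hr & HR) & HX).
  destruct (qform_param 1 b P ltac:(lra) ltac:(lra) HP) as [x <-].
  destruct (qform_param 1 b Q ltac:(lra) ltac:(lra) HQ) as [y <-].
  assert (A := ca_pos). assert (B := cb_pos). assert (AA := ca_sq). assert (BB := cb_sq).
  assert (HR1 : confocal R0).
  { destruct Hv as (c & T & z & Hc & <- & _). apply (param_image _ _ _ Hc). now exists z. }
  destruct (qform_param ca cb R0 A B HR1) as [t Ht].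
  rewrite <- Ht in Hv. destruct (tangent_vector_inv ca cb t v A B Hv) as [k [Hk ->]].
  set (m := (x + y) / 2). set (d := (y - x) / 2).
  assert (Ex : x = m - d) by (unfold m, d; field). assert (Ey : y = m + d) by (unfold m, d; field).
  clearbody m d. subst x y.
  assert (V : vec (pt (m - d)) (pt (m + d)) = (- 2 * sin m * sin d, 2 * b * cos m * sin d)).
  { unfold vec, ellipse_pt. simpl. rewrite cos_minus, cos_plus, sin_minus, sin_plus. apply f_equal2; ring. }
  assert (Sd : sin d <> 0).
  { intros Z. apply N. unfold ellipse_pt. rewrite cos_minus, cos_plus, sin_minus, sin_plus, Z.
    apply f_equal2; ring. }
  rewrite V in HX. unfold cross in HX. cbn [fst snd] in HX.
  unfold vec in V. injection V. intros V2 V1. cbn [fst snd ellipse_pt] in V1, V2.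
  rewrite <- Ht in HR. unfold ellipse_pt in HR. cbn [fst snd] in HR. rewrite V1, V2 in HR.
  injection HR. intros R2 R1. clear HR V V1 V2.
  rewrite cos_minus in R1. rewrite sin_minus in R2.
  assert (T := sin2_cos2 m). assert (Tt := sin2_cos2 t). assert (Td := sin2_cos2 d). unfold Rsqr in *.
  set (X := ca * cos m). set (Y := cb / b * sin m).
  assert (E1 : X * cos t + Y * sin t = cos d).
  { transitivity (cos m * (ca * cos t) + / b * sin m * (cb * sin t)). unfold X, Y. field. lra.
    rewrite R1, R2. transitivity (cos d * (sin m * sin m + cos m * cos m)). field. lra. rewrite T. ring. }
  assert (E2 : X * sin t - Y * cos t = 0).
  { apply (Rmult_eq_reg_l (2 * b * sin d * k)).
    2: { repeat apply Rmult_integral_contrapositive_currified; auto; lra. }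
    rewrite Rmult_0_r. etransitivity; [|exact HX]. unfold X, Y. field. lra. }
  assert (E3 : X * X + Y * Y = cos d * cos d).
  { transitivity ((X * X + Y * Y) * (sin t * sin t + cos t * cos t)). rewrite Tt. ring.
    transitivity ((X * cos t + Y * sin t) * (X * cos t + Y * sin t) + (X * sin t - Y * cos t) * (X * sin t - Y * cos t)).
    ring. rewrite E1, E2. ring. }
  assert (E4 : cos d * cos d = cos (dl m) * cos (dl m)).
  { rewrite <- E3, cos_half_angle_sq, <- AA, <- BB. unfold X, Y. field. lra. }
  assert (E5 : sin d * sin d = sin (dl m) * sin (dl m)).
  { generalize (sin2_cos2 (dl m)). unfold Rsqr. lra. }
  assert (F1 : cos d = cos (dl m) \/ cos d = - cos (dl m)).
  { assert (F : (cos d - cos (dl m)) * (cos d + cos (dl m)) = 0) by lra.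
    apply Rmult_integral in F. destruct F; [left|right]; lra. }
  assert (F2 : sin d = sin (dl m) \/ sin d = - sin (dl m)).
  { assert (F : (sin d - sin (dl m)) * (sin d + sin (dl m)) = 0) by lra.
    apply Rmult_integral in F. destruct F; [left|right]; lra. }
  destruct F1 as [F1|F1]; destruct F2 as [F2|F2].
  - exists m. left. unfold ellipse_pt. rewrite !cos_minus, !cos_plus, !sin_minus, !sin_plus, F1, F2. auto.
  - exists m. right. unfold ellipse_pt. rewrite !cos_minus, !cos_plus, !sin_minus, !sin_plus, F1, F2.
    split; apply f_equal2; ring.
  - exists (m + PI). right. rewrite half_angle_pi. unfold ellipse_pt.
    rewrite !cos_minus, !(cos_plus _ (dl m)), !(cos_plus m d), !sin_minus, !(sin_plus _ (dl m)), !(sin_plus m d), neg_cos, neg_sin, F1, F2.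
    split; apply f_equal2; ring.
  - exists (m + PI). left. rewrite half_angle_pi. unfold ellipse_pt.
    rewrite !cos_minus, !(cos_plus _ (dl m)), !(cos_plus m d), !sin_minus, !(sin_plus _ (dl m)), !(sin_plus m d), neg_cos, neg_sin, F1, F2.
    split; apply f_equal2; ring.
Qed.

(** * The invariant coordinate *)

Local Notation gg := (gint b s).
Local Notation rot := (2 * gint b s (asin s)).
Local Notation per := (4 * gint b s (PI / 2)).

Lemma gint_quarter_pos : 0 < gg (PI / 2).
Proof. generalize (gint_quarter_lower b s ltac:(lra) ltac:(lra)) PI2_bounds. lra. Qed.

Lemma gint_onto y : { x | gg x = y }.
Proof.
  assert (W := gint_quarter_pos).
  destruct (archimedean_nat (Rabs y / per)) as [k Hk].
  assert (Hy : Rabs y < INR k * per).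
  { apply (Rmult_lt_reg_r (/ per)). apply Rinv_0_lt_compat; lra.
    replace (INR k * per * / per) with (INR k) by (field; lra). exact Hk. }
  assert (E := gint_shift b s 0 k ltac:(lra) ltac:(lra)). rewrite gint_0, !Rplus_0_l in E.
  destruct (IVT_gen gg (- (INR k * (2 * PI))) (INR k * (2 * PI)) y) as [x [_ Hx]].
  - intros z. apply derivable_continuous_pt. eexists. apply is_derive_Reals.
    apply gint_derive; lra.
  - rewrite gint_opp, E by lra. apply Rabs_lt_between in Hy.
    rewrite Rmin_left, Rmax_right by lra. lra.
  - exists x. exact Hx.
Qed.

(** Inverse of an elliptic integral of the first kind, in the role of the Jacobi amplitude: it
    recovers the eccentric angle from the coordinate in which the billiard map is a rotation. *)
Definition phi (y : R) : R := proj1_sig (gint_onto y).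

Lemma gint_phi y : gg (phi y) = y.
Proof. apply (proj2_sig (gint_onto y)). Qed.

Lemma gint_injective x y : gg x = gg y -> x = y.
Proof.
  intros H. destruct (Rtotal_order x y) as [L|[L|L]]; auto;
    apply (gint_increasing b s) in L; lra.
Qed.

Lemma phi_increasing x y : x < y -> phi x < phi y.
Proof.
  intros H. apply Rnot_le_lt. intros [L|L].
  - apply (gint_increasing b s) in L; try lra. rewrite !gint_phi in L. lra.
  - apply (f_equal gg) in L. rewrite !gint_phi in L. lra.
Qed.

Lemma phi_shift y k : phi (y + INR k * per) = phi y + INR k * (2 * PI).
Proof. apply gint_injective. rewrite gint_shift, !gint_phi by lra. reflexivity. Qed.

Lemma rot_bounds : 0 < rot < per.
Proof.
  assert (P2 := PI2_bounds). assert (B := asin_bound_lt s ltac:(lra)).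
  assert (A : asin 0 < asin s) by (apply asin_increasing; lra). rewrite asin_0 in A.
  assert (H1 := gint_increasing b s 0 (asin s) ltac:(lra) ltac:(lra) A). rewrite gint_0 in H1.
  assert (H2 := gint_increasing b s (asin s) (PI / 2) ltac:(lra) ltac:(lra) (proj2 B)). lra.
Qed.

Lemma phi_step y : exists m, phi y = m - dl m /\ phi (y + rot) = m + dl m.
Proof.
  destruct (link_start_exists b s Hs Hb (phi y)) as [m Hm]. exists m. split; auto.
  apply gint_injective. rewrite gint_phi. generalize (gint_link b s Hs Hb m). rewrite Hm, gint_phi. lra.
Qed.

Definition ccw (y : R) (k : Z) : point := pt (phi (y + IZR k * rot)).

Lemma ccw_succ y k : y + IZR (k + 1) * rot = (y + IZR k * rot) + rot.
Proof. rewrite plus_IZR. ring. Qed.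

Lemma ccw_link y k : exists m, ccw y k = pt (m - dl m) /\ ccw y (k + 1) = pt (m + dl m) /\
  phi (y + IZR k * rot) = m - dl m /\ phi (y + IZR (k + 1) * rot) = m + dl m.
Proof.
  destruct (phi_step (y + IZR k * rot)) as [m [H1 H2]]. rewrite <- ccw_succ in H2.
  exists m. unfold ccw. rewrite H1, H2. auto.
Qed.

Lemma ccw_neq y k : ccw y k <> ccw y (k + 1).
Proof. destruct (ccw_link y k) as (m & -> & -> & _). apply link_neq. Qed.

Lemma ccw_boundary y k : qform 1 b (ccw y k) = 1.
Proof. apply qform_ellipse_pt; lra. Qed.

Lemma ccw_reflects y k v : tangent_vector (boundary (disk b)) (ccw y (k + 1)) v ->
  v <> (0, 0) /\ reflects (ccw y k) (ccw y (k + 1)) (ccw y (k + 1 + 1)) v.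
Proof.
  intros Hv. split.
  - destruct Hv as (c & T & t & Hc & _ & <-). apply (param_regular _ _ _ Hc).
  - rewrite boundary_disk_eq in Hv by lra.
    destruct (ccw_link y k) as (m & E1 & E2 & F1 & F2).
    destruct (ccw_link y (k + 1)) as (m' & E3 & E4 & F3 & F4).
    rewrite E2 in Hv. apply tangent_vector_inv in Hv; try lra. destruct Hv as (r & Hr & ->).
    rewrite E1, E4, E2. apply reflects_scale, reflects_link. now rewrite <- F2, <- F3.
Qed.

Lemma orbit_forward x y k : billiard_orbit (disk b) x ->
  x k = ccw y k -> x (k + 1)%Z = ccw y (k + 1) -> x (k + 1 + 1)%Z = ccw y (k + 1 + 1).
Proof.
  intros (B1 & B2 & B3) E1 E2.
  destruct (B3 (k + 1)%Z) as (v & Hv & Hr). replace (k + 1 - 1)%Z with k in Hr by ring.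
  rewrite E1, E2 in Hr. rewrite E2 in Hv. destruct (ccw_reflects y k v Hv) as [Nv Hr'].
  apply (reflects_unique b (ccw y k) (ccw y (k + 1)) _ _ v); auto; try apply ccw_boundary; try lra.
  - apply boundary_disk. lra. apply B1.
  - rewrite <- E2. apply B2.
  - apply ccw_neq.
Qed.

Lemma orbit_backward x y k : billiard_orbit (disk b) x ->
  x (k + 1)%Z = ccw y (k + 1) -> x (k + 1 + 1)%Z = ccw y (k + 1 + 1) -> x k = ccw y k.
Proof.
  intros (B1 & B2 & B3) E1 E2.
  destruct (B3 (k + 1)%Z) as (v & Hv & Hr). replace (k + 1 - 1)%Z with k in Hr by ring.
  rewrite E1, E2 in Hr. rewrite E1 in Hv. destruct (ccw_reflects y k v Hv) as [Nv Hr'].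
  apply reflects_reverse in Hr, Hr'.
  apply (reflects_unique b (ccw y (k + 1 + 1)) (ccw y (k + 1)) _ _ v); auto; try apply ccw_boundary; try lra.
  - apply boundary_disk. lra. apply B1.
  - rewrite <- E1. intros H. apply (B2 k). now symmetry.
  - intros H. apply (ccw_neq y k). now symmetry.
Qed.

(** Two consecutive points determine the whole bi-infinite orbit: the reflection law yields the next
    point and, read backwards, the previous one. *)
Lemma orbit_is_ccw x y k : billiard_orbit (disk b) x ->
  x k = ccw y k -> x (k + 1)%Z = ccw y (k + 1) -> forall i, x i = ccw y i.
Proof.
  intros B E1 E2.
  assert (H : forall i, x (k + i)%Z = ccw y (k + i) /\ x (k + i + 1)%Z = ccw y (k + i + 1)).
  { apply (Z.bi_induction (fun i => x (k + i)%Z = ccw y (k + i) /\ x (k + i + 1)%Z = ccw y (k + i + 1))).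
    - intros i j ->. reflexivity.
    - now rewrite Z.add_0_r.
    - intros i. replace (k + Z.succ i)%Z with (k + i + 1)%Z by ring. split; intros [H1 H2].
      + split; auto. now apply orbit_forward.
      + split; auto. now apply orbit_backward. }
  intros i. replace i with (k + (i - k))%Z by ring. apply H.
Qed.

Lemma mirror_exists : exists M, sim_k M = 1 /\ forall P, sim_app M P = (fst P, - snd P).
Proof.
  assert (H1 : -1 * -1 = 1) by ring. assert (H2 : 1 * 1 + 0 * 0 = 1 * 1) by ring.
  exists (Sim 0 0 1 0 (-1) 1 H1 H2 Rlt_0_1). split. reflexivity.
  intros P. unfold sim_app, sim_lin. simpl. apply f_equal2; ring.
Qed.

Lemma mirror_related M A B (f : R -> Prop) : (forall P, sim_app M P = (fst P, - snd P)) ->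
  related M (fun P => f (qform A B P)) (fun P => f (qform A B P)).
Proof.
  intros HM P. rewrite HM. unfold qform. simpl.
  replace (- snd P * - snd P) with (snd P * snd P) by ring. reflexivity.
Qed.

(** If the given tangent link runs clockwise, reflection in the major axis, which preserves both
    ellipses and replaces [m] by [- m], makes it counterclockwise. *)
Lemma tangent_orbit_ccw x : tangent_orbit (disk b) confocal x ->
  exists y, (forall k, x k = ccw y k) \/ (forall k, x k = (fst (ccw y k), - snd (ccw y k))).
Proof.
  assert (Main : forall x m k, billiard_orbit (disk b) x -> x k = pt (m - dl m) -> x (k + 1)%Z = pt (m + dl m) ->
    exists y, forall k, x k = ccw y k).
  { intros z m k B E1 E2. exists (gg (m - dl m) - IZR k * rot).
    apply (orbit_is_ccw z _ k); auto; unfold ccw.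
    - rewrite E1. f_equal. apply gint_injective. rewrite gint_phi. ring.
    - rewrite E2. f_equal. apply gint_injective. rewrite gint_phi, plus_IZR.
      generalize (gint_link b s Hs Hb m). lra. }
  intros [B [k Hk]]. assert (B' := B). destruct B' as (B1 & B2 & B3).
  destruct (tangent_link_form (x k) (x (k + 1)%Z)) as [m [[E1 E2]|[E1 E2]]]; auto.
  - apply boundary_disk. lra. apply B1.
  - apply boundary_disk. lra. apply B1.
  - destruct (Main x m k B E1 E2) as [y Hy]. exists y. now left.
  - destruct mirror_exists as (M & _ & HM).
    assert (R1 : related M (disk b) (disk b)) by apply (mirror_related M 1 b (fun z => z < 1) HM).
    assert (R2 : related M confocal confocal) by apply (mirror_related M ca cb (fun z => z = 1) HM).
    destruct (tangent_orbit_app M (disk b) (disk b) confocal confocal x R1 R2) as [BM _].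
    { split; auto. now exists k. }
    destruct (Main (fun i => sim_app M (x i)) (- m) k BM) as [y Hy].
    + cbv beta. rewrite HM, half_angle_opp, E1. unfold ellipse_pt. cbn [fst snd].
      replace (- m - dl m) with (- (m + dl m)) by ring. rewrite cos_neg, sin_neg. apply f_equal2; ring.
    + cbv beta. rewrite HM, half_angle_opp, E2. unfold ellipse_pt. cbn [fst snd].
      replace (- m + dl m) with (- (m - dl m)) by ring. rewrite cos_neg, sin_neg. apply f_equal2; ring.
    + exists y. right. intros i. specialize (Hy i). cbv beta in Hy. rewrite HM in Hy. rewrite <- Hy.
      cbn [fst snd]. rewrite Ropp_involutive. apply surjective_pairing.
Qed.

Lemma arclength_ellipse_pt x y : arclength pt x y = kint b 0 y - kint b 0 x.
Proof.
  unfold arclength, kint. rewrite <- (RInt_as_primitive _ x y) by apply radical_continuous.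
  apply RInt_ext. intros t _. unfold speed, radical. f_equal.
  rewrite velocity_ellipse_pt. unfold dot, speed_sq. simpl. ring.
Qed.

Lemma sum_n_telescope (c : R) (f : nat -> R) n :
  sum_n (fun i => c + (f (S i) - f i)) n = INR (S n) * c + (f (S n) - f O).
Proof.
  induction n as [|n IH].
  - rewrite sum_O. simpl. ring.
  - rewrite sum_Sn, IH. change (INR (S n) * c + (f (S n) - f O) + (c + (f (S (S n)) - f (S n))) =
      INR (S (S n)) * c + (f (S (S n)) - f O)). rewrite (S_INR (S n)). ring.
Qed.

(** * Orbits that close up *)

Section Closed.
Variables p q : nat.
Hypothesis Hp : (0 < p)%nat.
Hypothesis Hpq : (2 * p < q)%nat.
Hypothesis Hgcd : Z.gcd (Z.of_nat p) (Z.of_nat q) = 1%Z.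
Hypothesis Hclose : INR q * gg (asin s) = 2 * INR p * gg (PI / 2).

Lemma closing y k : phi (y + IZR (k + Z.of_nat q) * rot) = phi (y + IZR k * rot) + INR p * (2 * PI).
Proof.
  rewrite <- phi_shift. f_equal. rewrite plus_IZR, <- INR_IZR_INZ.
  replace (y + (IZR k + INR q) * rot) with (y + IZR k * rot + 2 * (INR q * gg (asin s))) by ring.
  rewrite Hclose. ring.
Qed.

Lemma ellipse_pt_period x k : pt (x + INR k * (2 * PI)) = pt x.
Proof.
  unfold ellipse_pt. rewrite INR_IZR_INZ. destruct (trig_period_Z x (Z.of_nat k)) as [-> ->]. reflexivity.
Qed.

Lemma ccw_period y : has_period (ccw y) q.
Proof.
  split. lia. intros k. unfold ccw. rewrite closing. apply ellipse_pt_period.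
Qed.

(** A return after [r] bounces advances the coordinate by [i] full turns, so the closing condition
    gives [r * p = i * q], and coprimality makes [q] divide [r]. *)
Lemma ccw_minimal_period y : minimal_period (ccw y) q.
Proof.
  split. apply ccw_period. intros r [Hr H]. specialize (H 0%Z).
  unfold ccw in H. rewrite Z.add_0_l, Rmult_0_l, Rplus_0_r in H.
  unfold ellipse_pt in H. injection H. intros H2 H1.
  destruct (trig_eq_period (phi (y + IZR (Z.of_nat r) * rot)) (phi y)) as [j Hj].
  { apply (Rmult_eq_reg_l 1); lra. }
  { apply (Rmult_eq_reg_l b); lra. }
  rewrite <- INR_IZR_INZ in Hj.
  assert (RB := rot_bounds).
  assert (Rr : 0 < INR r) by (apply (lt_INR 0); auto).
  assert (L := phi_increasing y (y + INR r * rot) ltac:(nra)). 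
  assert (PP := PI_RGT_0).
  (* Monotonicity of [phi] makes the number of turns nonnegative, so that the shift law over natural
     numbers applies. *)
  assert (j0 : (0 <= j)%Z).
  { apply le_IZR. apply Rnot_lt_le. intros F. rewrite Hj in L. nra. }
  rewrite <- (Z2Nat.id j j0), <- INR_IZR_INZ, <- phi_shift in Hj.
  apply (f_equal gg) in Hj. rewrite !gint_phi in Hj.
  set (i := Z.to_nat j) in *.
  assert (E : INR r * INR p = INR i * INR q).
  { apply (Rmult_eq_reg_r (gg (PI / 2))). 2: generalize gint_quarter_pos; lra.
    transitivity (INR q * (INR r * rot) / 4).
    - transitivity (INR r * (2 * INR p * gg (PI / 2)) / 2). field. rewrite <- Hclose. field.
    - replace (INR r * rot) with (INR i * per) by lra. field. }
  rewrite <- !mult_INR in E. apply INR_eq in E.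
  assert (D : (Z.of_nat q | Z.of_nat r)%Z).
  { apply (Z.gauss _ (Z.of_nat p)).
    - exists (Z.of_nat i). lia.
    - now rewrite Z.gcd_comm. }
  apply Z.divide_pos_le in D; lia.
Qed.

Lemma ccw_type y : orbit_type (disk b) (ccw y) p q.
Proof.
  assert (RB := rot_bounds). assert (PP := PI_RGT_0).
  split; [apply ccw_minimal_period|]. split; [lia|].
  exists pt, (2 * PI), (fun k => phi (y + IZR k * rot)). split; [|split; [|split]].
  - rewrite boundary_disk_eq by lra. apply parametrizes_ellipse_pt; lra.
  - reflexivity.
  - intros k. rewrite ccw_succ. split.
    + apply phi_increasing. lra.
    + assert (E := phi_shift (y + IZR k * rot) 1). simpl INR in E. rewrite !Rmult_1_l in E.
      rewrite <- E. apply phi_increasing. lra.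
  - intros k. rewrite !arclength_ellipse_pt, closing, kint_shift.
    replace (2 * PI) with (0 + INR 1 * (2 * PI)) by (simpl; ring). rewrite kint_shift. simpl. ring.
Qed.

Lemma ccw_length y : orbit_length (ccw y) q = closed_length (INR p) (INR q) b s.
Proof.
  unfold orbit_length.
  rewrite (sum_n_ext _ (fun i => (2 * b * s - 2 * kint b s (asin s)) +
    (kint b s (phi (y + IZR (Z.of_nat (S i)) * rot)) - kint b s (phi (y + IZR (Z.of_nat i) * rot))))).
  - rewrite (sum_n_telescope _ (fun i => kint b s (phi (y + IZR (Z.of_nat i) * rot)))).
    replace (S (pred q)) with q by lia. rewrite <- (Z.add_0_l (Z.of_nat q)), closing, kint_shift.
    change (Z.of_nat 0) with 0%Z. unfold closed_length. ring.
  - intros i. rewrite Nat2Z.inj_succ, <- Z.add_1_r.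
    destruct (ccw_link y (Z.of_nat i)) as (m & -> & -> & -> & ->).
    rewrite edist_link. generalize (kint_link b s Hs Hb m). lra.
Qed.

(** Every claim on tangent orbits reduces to [ccw] and to its image under an isometry preserving the
    domain and the caustic, where the transport lemmas finish. *)
Lemma orbit_cases x (R : (Z -> point) -> Prop) : tangent_orbit (disk b) confocal x ->
  (forall y, R (ccw y)) ->
  (forall M y, sim_k M = 1 -> related M (disk b) (disk b) -> related M confocal confocal ->
    R (fun k => sim_app M (ccw y k))) -> R x.
Proof.
  intros Hx H1 H2. destruct (tangent_orbit_ccw x Hx) as [y [E|E]].
  - replace x with (ccw y). apply H1. symmetry. now apply functional_extensionality.
  - destruct mirror_exists as (M & HK & HM).
    replace x with (fun k => sim_app M (ccw y k)).
    + apply H2; auto. apply (mirror_related M 1 b (fun z => z < 1) HM). apply (mirror_related M ca cb (fun z => z = 1) HM).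
    + apply functional_extensionality. intros k. now rewrite HM, E.
Qed.

Lemma confocal_type : rational_caustic_of_type (disk b) confocal p q.
Proof.
  split; [split; [split; [|split]|]|].
  - exists (ellipse_pt ca cb), (2 * PI). apply parametrizes_ellipse_pt. apply ca_pos. apply cb_pos.
  - apply confocal_inside.
  - intros x Hx. apply (orbit_cases x (fun x => forall k, tangent_link confocal (x k) (x (k + 1)%Z))); auto.
    + intros y k. destruct (ccw_link y k) as (m & -> & -> & _). apply link_tangent.
    + intros M y _ _ HM k. apply (tangent_link_app M confocal); auto.
      destruct (ccw_link y k) as (m & -> & -> & _). apply link_tangent.
  - intros x Hx. exists q. apply (orbit_cases x (fun x => has_period x q)); auto.
    + apply ccw_period.
    + intros M y _ _ _. apply has_period_app, ccw_period.
  - intros x Hx. apply (orbit_cases x (fun x => orbit_type (disk b) x p q)); auto.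
    + apply ccw_type.
    + intros M y _ HM _. apply (orbit_type_app M (disk b)); auto. apply ccw_type.
Qed.

Lemma confocal_length x : tangent_orbit (disk b) confocal x ->
  orbit_length x q = closed_length (INR p) (INR q) b s.
Proof.
  intros Hx. apply (orbit_cases x (fun x => orbit_length x q = closed_length (INR p) (INR q) b s)); auto.
  - apply ccw_length.
  - intros M y HK _ _. rewrite orbit_length_app, HK, ccw_length. ring.
Qed.

End Closed.
End Caustic.

(** * Two caustics in one ellipse, and density *)

Lemma confocal_neq b s s' : 0 < s < 1 -> 0 < s' < 1 -> s <> s' -> confocal b s <> confocal b s'.
Proof.
  intros Hs Hs' N E.
  assert (H : confocal b s (sqrt (1 - s * s), 0)).
  { unfold confocal, qform. simpl. assert (0 < sqrt (1 - s * s)) by (apply sqrt_lt_R0; nra).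
    unfold Rdiv. rewrite !Rmult_0_l, Rplus_0_r. field. lra. }
  rewrite E in H. unfold confocal, qform in H. simpl in H.
  rewrite !sqrt_sqrt in H by nra. unfold Rdiv in H. rewrite !Rmult_0_l, Rplus_0_r in H.
  apply N. assert (Z : 1 - s * s = 1 - s' * s').
  { apply (Rmult_eq_reg_r (/ (1 - s' * s'))). rewrite H. field. nra. apply Rinv_neq_0_compat. nra. }
  nra.
Qed.

Lemma disk_equal_length b s s' p q p' q' : b < 1 -> 0 < s < b -> 0 < s' < b ->
  (0 < p)%nat -> (2 * p < q)%nat -> (0 < p')%nat -> (2 * p' < q')%nat ->
  Z.gcd (Z.of_nat p) (Z.of_nat q) = 1%Z -> Z.gcd (Z.of_nat p') (Z.of_nat q') = 1%Z ->
  (p * q' < p' * q)%nat ->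
  INR q * gint b s (asin s) = 2 * INR p * gint b s (PI / 2) ->
  INR q' * gint b s' (asin s') = 2 * INR p' * gint b s' (PI / 2) ->
  closed_length (INR p) (INR q) b s = closed_length (INR p') (INR q') b s' ->
  equal_length_caustics (disk b) p q p' q'.
Proof.
  intros Hb Hs Hs' H1 H2 H3 H4 H5 H6 H7 H8 H9 H10.
  exists (confocal b s), (confocal b s'). split; [|split; [|split; [|split]]].
  (* A caustic has a single rotation number, so a common [s] would give [p * q' = p' * q]. *)
  - apply confocal_neq; try lra. intros <-.
    assert (G := gint_quarter_pos b s Hs Hb).
    assert (G' := rot_bounds b s Hs Hb).
    assert (E : INR p * INR q' = INR p' * INR q).
    { apply (Rmult_eq_reg_r (2 * gint b s (PI / 2) * gint b s (asin s))); [|nra].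
      transitivity ((2 * INR p * gint b s (PI / 2)) * (INR q' * gint b s (asin s))). ring.
      rewrite <- H8, H9. ring. }
    rewrite <- !mult_INR in E. apply INR_eq in E. lia.
  - apply confocal_type; auto.
  - apply confocal_type; auto.
  - intros E. injection E. intros -> ->. lia.
  - exists (closed_length (INR p) (INR q) b s). split.
    + intros x Hx. now apply confocal_length.
    + intros x Hx. rewrite H10. now apply confocal_length.
Qed.

Lemma ellipse_similar (F1 F2 : point) (a b : R) : 0 < b < 1 -> 0 < a ->
  edist F1 F2 = 2 * a * sqrt (1 - b * b) -> exists M, related M (disk b) (ellipse F1 F2 a).
Proof.
  intros Hb Ha Hd. set (c := sqrt (1 - b * b)) in *.
  assert (Hc : 0 < c) by (apply sqrt_lt_R0; nra).
  assert (Hcc : c * c = 1 - b * b) by (apply sqrt_sqrt; nra).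
  destruct F1 as [x1 y1], F2 as [x2 y2].
  assert (D : (x1 - x2) * (x1 - x2) + (y1 - y2) * (y1 - y2) = 4 * (a * a) * (c * c)).
  { transitivity (edist (x1, y1) (x2, y2) * edist (x1, y1) (x2, y2)).
    - unfold edist, dist_euc, Rsqr. simpl. rewrite sqrt_sqrt. reflexivity.
      generalize (Rle_0_sqr (x1 - x2)) (Rle_0_sqr (y1 - y2)). unfold Rsqr. lra.
    - rewrite Hd. ring. }
  assert (N : (x2 - x1) / (2 * c) * ((x2 - x1) / (2 * c)) + (y2 - y1) / (2 * c) * ((y2 - y1) / (2 * c)) = a * a).
  { transitivity (((x1 - x2) * (x1 - x2) + (y1 - y2) * (y1 - y2)) / (4 * (c * c))). field. lra.
    rewrite D. field. lra. }
  assert (S : 1 * 1 = 1) by ring.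
  set (M := Sim ((x1 + x2) / 2) ((y1 + y2) / 2) ((x2 - x1) / (2 * c)) ((y2 - y1) / (2 * c)) 1 a S N Ha).
  assert (M1 : sim_app M (- c, 0) = (x1, y1)) by (unfold sim_app, sim_lin; simpl; apply f_equal2; field; lra).
  assert (M2 : sim_app M (c, 0) = (x2, y2)) by (unfold sim_app, sim_lin; simpl; apply f_equal2; field; lra).
  exists M. intros P. unfold ellipse. rewrite <- M1, <- M2, !edist_sim_app.
  change (sim_k M) with a. unfold disk. rewrite <- (focal_ellipse b c) by lra.
  rewrite <- Rmult_plus_distr_l, (Rmult_comm 2 a). split; intros H.
  - now apply Rmult_lt_reg_l in H.
  - now apply Rmult_lt_compat_l.
Qed.

Lemma dense_equal_length (m n : Z) : n <> 0%Z ->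
  exists E : R -> Prop, dense_in_01 E /\
    forall e, E e -> forall (F1 F2 : point) (a : R), edist F1 F2 < 2 * a ->
      eccentricity F1 F2 a = e ->
      exists p q p' q' : nat, equal_length_caustics (ellipse F1 F2 a) p q p' q' /\
        (Z.of_nat q mod n = (Z.of_nat q' + m) mod n)%Z.
Proof.
  intros Hn.
  (* [E] is the set of all eccentricities with the required property, so density only asks for one
     member near each [e0]. *)
  exists (fun e => 0 <= e < 1 /\ forall (F1 F2 : point) (a : R), edist F1 F2 < 2 * a ->
      eccentricity F1 F2 a = e ->
      exists p q p' q' : nat, equal_length_caustics (ellipse F1 F2 a) p q p' q' /\
        (Z.of_nat q mod n = (Z.of_nat q' + m) mod n)%Z).
  split; [split|]; [now intros e [He _]| |now intros e [_ He]].
  intros e0 He0 eps Heps.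
  set (d := Rmin eps (1 - e0)).
  assert (D1 : d <= eps) by apply Rmin_l. assert (D2 : d <= 1 - e0) by apply Rmin_r.
  assert (D0 : 0 < d) by (apply Rmin_pos; lra).
  (* The interval lies strictly to the right of [e0], so [e1 > 0] even for [e0 = 0]; this gives
     [b1 < 1] and keeps the circle out. *)
  set (e1 := e0 + d / 3). set (e2 := e0 + 2 * (d / 3)).
  assert (H1 : e0 < e1 < e2) by (unfold e1, e2; lra).
  assert (H2 : e2 < 1 /\ e2 < e0 + eps) by (unfold e2; lra).
  set (b1 := sqrt (1 - e1 * e1)). set (b2 := sqrt (1 - e2 * e2)).
  assert (B2 : 0 < b2) by (apply sqrt_lt_R0; nra).
  assert (B12 : b2 < b1) by (apply sqrt_lt_1; nra).
  assert (Q1 : b1 * b1 = 1 - e1 * e1) by (apply sqrt_sqrt; nra).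
  assert (Q2 : b2 * b2 = 1 - e2 * e2) by (apply sqrt_sqrt; nra).
  assert (B1 : b1 < 1) by nra.
  destruct (equal_closed_lengths b1 b2 m n ltac:(lra) B1 Hn)
    as (b & s & s' & p & q & p' & q' & Hb & Hs & Hs' & K1 & K2 & K3 & K4 & K5 & K6 & K7 & K8 & K9 & K10 & K11).
  set (e := sqrt (1 - b * b)).
  assert (Hbb : 0 < b < 1) by lra.
  assert (He : 0 < e) by (apply sqrt_lt_R0; nra).
  assert (Qe : e * e = 1 - b * b) by (apply sqrt_sqrt; nra).
  assert (He12 : e1 <= e <= e2).
  { assert (b2 * b2 <= b * b) by nra. assert (b * b <= b1 * b1) by nra.
    split; apply Rnot_lt_le; intros F; nra. }
  exists e. split; [split; [lra|]|].
  - intros F1 F2 a Ha Hecc. exists p, q, p', q'. split; auto.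
    assert (Ha0 : 0 < a).
    { assert (0 <= edist F1 F2) by (unfold edist; apply sqrt_pos). lra. }
    destruct (ellipse_similar F1 F2 a b Hbb Ha0) as [M HM].
    + fold e. rewrite <- Hecc. unfold eccentricity. field. lra.
    + apply (equal_length_app M (disk b)); auto.
      apply (disk_equal_length b s s'); auto. lra.
  - apply Rabs_lt_between. lra.
Qed.

Theorem theorem5p5 :
  (exists E : R -> Prop, dense_in_01 E /\
     forall e, E e ->
     forall (F1 F2 : point) (a : R), edist F1 F2 < 2 * a ->
       eccentricity F1 F2 a = e ->
       exists p q p' q' : nat,
         equal_length_caustics (ellipse F1 F2 a) p q p' q')
  /\
  (forall m n : Z, n <> 0%Z ->
   exists E : R -> Prop, dense_in_01 E /\
     forall e, E e ->
     forall (F1 F2 : point) (a : R), edist F1 F2 < 2 * a ->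
       eccentricity F1 F2 a = e ->
       exists p q p' q' : nat,
         equal_length_caustics (ellipse F1 F2 a) p q p' q' /\
         (Z.of_nat q mod n = (Z.of_nat q' + m) mod n)%Z).
Proof.
  split; [|exact dense_equal_length].
  destruct (dense_equal_length 0 1 ltac:(discriminate)) as [E [HE H]].
  exists E. split; auto. intros e He F1 F2 a Ha Hecc.
  destruct (H e He F1 F2 a Ha Hecc) as (p & q & p' & q' & K & _). now exists p, q, p', q'.
Qed.
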